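(* Let $\Omega\subset\mathbb{R}^d$ be bounded and open and let $\nu:\mathbb{R}^d\setminus\{0\}\to[0,\infty)$ be the density of a symmetric Lévy measure with full support. Assume that $(\nu,\Omega)$ belongs to one of the classes $\mathscr{A}_i$, $i=1,2,3$. Let $k:(\mathbb{R}^d\times\mathbb{R}^d)\setminus\operatorname{diag}\to[0,\infty)$ be symmetric and measurable with $\Lambda^{-1}\nu(y-x)\le k(x,y)\le\Lambda\nu(y-x)$ for all $x\ne y$ and some $\Lambda\ge1$. Let $\beta:\Omega^c\to[0,\infty)$ be measurable such that $\beta\widetilde\nu^{-1}:\Omega^c\to[0,\infty)$ is essentially bounded and $|\Omega^c\cap\{\beta>0\}|>0$. Let $f\in L^2(\Omega)$ and $g\in L^2(\Omega^c,\widetilde\nu^{-1})$. Then there exists a unique $u\in V_\nu(\Omega|\mathbb{R}^d)$ such that $$\mathcal{E}(u,v)+\int_{\Omega^c}u(y)v(y)\beta(y)\,dy=\int_\Omega f(x)v(x)\,dx+\int_{\Omega^c}g(y)v(y)\,dy\qquad\text{for all }v\in V_\nu(\Omega|\mathbb{R}^d)$$ (i.e. a unique weak solution of the Robin problem $Lu=f$ in $\Omega$, $\mathcal{N}u+\beta u=g$ on $\Omega^c$), and it satisfies $$\|u\|_{V_\nu(\Omega|\mathbb{R}^d)}\le C\big(\|f\|_{L^2(\Omega)}+\|g\|_{L^2(\Omega^c,\widetilde\nu^{-1})}\big),$$ where $C=C(d,\Omega,\Lambda,\nu,\beta)>0$ can be chosen independently of $u$, $f$ and $g$.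
   Context: $V_\nu(\Omega|\mathbb{R}^d)$ is the space of (a.e.-classes of) measurable $u:\mathbb{R}^d\to\mathbb{R}$ with $u|_\Omega\in L^2(\Omega)$ and $|u|^2=\int_\Omega\int_{\mathbb{R}^d}(u(x)-u(y))^2\nu(x-y)\,dy\,dx<\infty$, normed by $\|u\|^2_{V_\nu(\Omega|\mathbb{R}^d)}=\|u\|^2_{L^2(\Omega)}+|u|^2$. $\mathcal{E}(u,v)=\frac12\iint_{(\Omega^c\times\Omega^c)^c}(u(x)-u(y))(v(x)-v(y))k(x,y)\,dx\,dy$. $\widetilde\nu(x)=\int_B(1\wedge\nu(x-y))\,dy$ for a fixed nonempty open $B\subset\Omega$; $L^2(\Omega^c,\widetilde\nu^{-1})$ is the $L^2$-space for $\widetilde\nu(x)^{-1}dx$ on $\Omega^c$. $Lu(x)=\mathrm{p.v.}\int(u(x)-u(y))k(x,y)dy$, $\mathcal{N}u(y)=\int_\Omega(u(y)-u(x))k(x,y)dx$. Full support: the support of $\nu(h)\,dh$ is $\mathbb{R}^d$. $H_\nu(\Omega)=\{u\in L^2(\Omega):\mathcal{E}_\Omega(u,u)<\infty\}$, $\mathcal{E}_\Omega(u,u)=\iint_{\Omega\times\Omega}(u(x)-u(y))^2\nu(x-y)\,dx\,dy$, $\|u\|^2_{H_\nu(\Omega)}=\|u\|^2_{L^2(\Omega)}+\mathcal{E}_\Omega(u,u)$ (similarly on $\mathbb{R}^d$). Classes: let $\Omega$ be open and bounded, $\nu$ measurable with $\nu(h)=\nu(-h)$, $\int_{\mathbb{R}^d}(1\wedge|h|^2)\nu(h)\,dh<\infty$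 and $\int_{\mathbb{R}^d}\nu(h)\,dh=\infty$. $(\nu,\Omega)$ is in $\mathscr{A}_1$ if there is $E:H_\nu(\Omega)\to H_\nu(\mathbb{R}^d)$ and $C>0$ with $\|Eu\|_{H_\nu(\mathbb{R}^d)}\le C\|u\|_{H_\nu(\Omega)}$, $Eu|_\Omega=u$ for every $u\in H_\nu(\Omega)$; in $\mathscr{A}_2$ if $\partial\Omega$ is Lipschitz-continuous, $\nu$ is radial and $\delta^{-2}\int_{B_\delta(0)}|h|^2\nu(h)\,dh\to\infty$ as $\delta\to0$; in $\mathscr{A}_3$ if $\inf_{a\in\partial\Omega}\int_{\Omega_\delta}\nu(h-a)\,dh\to\infty$ as $\delta\to0$, where $\Omega_\delta=\{x\in\Omega:\operatorname{dist}(x,\partial\Omega)>\delta\}$. *)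

(* Defs.v *)
From HB Require Import structures.
From mathcomp Require Import all_boot all_order all_algebra.
From mathcomp Require Import all_classical all_reals all_analysis.
From mathcomp Require Import measurable_realfun.

Set Implicit Arguments.
Unset Strict Implicit.
Unset Printing Implicit Defensive.

Import Order.TTheory GRing.Theory Num.Theory.
Import numFieldNormedType.Exports.

Local Open Scope classical_set_scope.
Local Open Scope ring_scope.

(* R^n is 'rV[R]_n. Its sigma-algebra is the one generated by the coordinate
   maps, i.e. the Borel sigma-algebra (see measurable_rVE). *)

Section measurable_rV.
Context {R : realType}.
Variable n : nat.

Definition rV_coord (i : 'I_n) (x : 'rV[R]_n) : R := x ord0 i.

Let rV_set0 : g_sigma_preimage rV_coord set0.
Proof. exact: sigma_algebra0. Qed.

Let rV_setC A :
  g_sigma_preimage rV_coord A -> g_sigma_preimage rV_coord (~` A).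
Proof. exact: sigma_algebraC. Qed.

Let rV_bigcup (F : (set 'rV[R]_n)^nat) :
  (forall i, g_sigma_preimage rV_coord (F i)) ->
  g_sigma_preimage rV_coord (\bigcup_i (F i)).
Proof. exact: sigma_algebra_bigcup. Qed.

HB.instance Definition _ := @isMeasurable.Build default_measure_display
  'rV[R]_n (g_sigma_preimage rV_coord) rV_set0 rV_setC rV_bigcup.

End measurable_rV.

Lemma measurable_rV_coord (R : realType) n (i : 'I_n) :
  measurable_fun [set: 'rV[R]_n] (fun x => x ord0 i).
Proof.
move=> _ Y mY; rewrite setTI; apply: sub_sigma_algebra => /=.
rewrite -bigcup_seq/=; exists i => /=; first by rewrite mem_index_enum.
by exists Y => //; rewrite setTI.
Qed.

Lemma measurable_fun_rVP (R : realType) d1 (T1 : measurableType d1) n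
    (f : T1 -> 'rV[R]_n) :
  measurable_fun [set: T1] f <->
  forall i, measurable_fun [set: T1] (fun t => f t ord0 i).
Proof.
apply: (@iff_trans _ (g_sigma_preimage
    (fun i => @rV_coord R n i \o f) `<=` measurable)).
  rewrite g_sigma_preimage_comp; split=> [mf A [/= C preC <-]|prefS].
    exact: mf.
  by move=> _ A mA; apply: prefS; exists A.
split=> [tnthfS i|mf].
- move=> _ A mA.
  apply: tnthfS; apply: sub_sigma_algebra.
  rewrite -bigcup_seq/=; exists i => /=; first by rewrite mem_index_enum.
  by exists A.
- apply: smallest_sub; first exact: sigma_algebra_measurable.
  move=> A; rewrite -bigcup_seq/= => -[i _ [B mB <-]].
  exact: mf.
Qed.

(* The measure on R^(n+1) obtained from lebesgue_measure \x m on R x R^n. *)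
Section lebesgue_rV_succ.
Context {R : realType} (n : nat).
Variable m : {sigma_finite_measure set 'rV[R]_n -> \bar R}.

Definition rV_cons (p : measurableTypeR R * 'rV[R]_n) : 'rV[R]_n.+1 :=
  row_mx (p.1)%:M p.2.

Lemma rV_cons0 p : rV_cons p ord0 ord0 = p.1.
Proof.
rewrite /rV_cons.
have -> : (ord0 : 'I_n.+1) = lshift n (ord0 : 'I_1) by apply/val_inj.
by rewrite (row_mxEl (p.1)%:M p.2) mxE eqxx.
Qed.

Lemma rV_consS p i : rV_cons p ord0 (lift ord0 i) = p.2 ord0 i.
Proof.
rewrite /rV_cons.
have -> : lift ord0 i = rshift 1 i by apply/val_inj.
by rewrite (row_mxEr (p.1)%:M p.2).
Qed.

Lemma measurable_rV_cons : measurable_fun setT rV_cons.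
Proof.
apply/measurable_fun_rVP => i; case: (unliftP ord0 i) => [j|] ->.
  under eq_fun do rewrite rV_consS.
  exact: (measurableT_comp (@measurable_rV_coord R n j)).
under eq_fun do rewrite rV_cons0.
exact: measurable_fst.
Qed.

Definition lebesgue_rV_succ : set 'rV[R]_n.+1 -> \bar R :=
  pushforward (lebesgue_measure \x m)%E rV_cons.

Let mpre A : measurable A -> measurable (rV_cons @^-1` A).
Proof. by move=> mA; rewrite -[X in measurable X]setTI; exact: measurable_rV_cons. Qed.

Let succ0 : lebesgue_rV_succ set0 = 0%E.
Proof. by rewrite /lebesgue_rV_succ /pushforward preimage_set0 measure0. Qed.

Let succ_ge0 A : (0 <= lebesgue_rV_succ A)%E.
Proof. by rewrite /lebesgue_rV_succ /pushforward; exact: measure_ge0. Qed.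

Let succ_sigma_additive : semi_sigma_additive lebesgue_rV_succ.
Proof.
move=> F mF tF mUF; rewrite /lebesgue_rV_succ /pushforward preimage_bigcup.
apply: measure_semi_sigma_additive.
- by move=> k; exact: mpre.
- apply/trivIsetP => /= i j _ _ ij; rewrite -preimage_setI.
  by move/trivIsetP : tF => /(_ _ _ _ _ ij) ->//; rewrite preimage_set0.
- by rewrite -preimage_bigcup; exact: mpre.
Qed.

HB.instance Definition _ := isMeasure.Build _ _ _
  lebesgue_rV_succ succ0 succ_ge0 succ_sigma_additive.

Lemma lebesgue_rV_succE (A : set R) (B : set 'rV[R]_n) :
  measurable A -> measurable B ->
  lebesgue_rV_succ [set x | A (x ord0 ord0) /\ B (\row_i x ord0 (lift ord0 i))] =
  (lebesgue_measure A * m B)%E.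
Proof.
move=> mA mB; rewrite -product_measure1E//.
rewrite /lebesgue_rV_succ /pushforward; congr (product_measure1 _ _ _).
apply/seteqP; split=> -[a b] /=; rewrite rV_cons0 => -[Aa Bb]; split => //.
  by move: Bb; congr B; apply/rowP => i; rewrite mxE rV_consS.
by move: Bb; congr B; apply/rowP => i; rewrite mxE rV_consS.
Qed.

Lemma measurable_rV_succ (A : set R) (B : set 'rV[R]_n) :
  measurable A -> measurable B ->
  measurable [set x : 'rV[R]_n.+1 |
    A (x ord0 ord0) /\ B (\row_i x ord0 (lift ord0 i))].
Proof.
move=> mA mB; apply: measurableI.
  rewrite -[X in measurable X]setTI.
  exact: (@measurable_rV_coord R n.+1 ord0 measurableT A mA).
have : measurable_fun setT
    (fun x : 'rV[R]_n.+1 => \row_(i < n) x ord0 (lift ord0 i)).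
  apply/measurable_fun_rVP => i; under eq_fun do rewrite mxE.
  exact: measurable_rV_coord.
by move=> /(_ measurableT B mB); rewrite setTI.
Qed.

Let succ_sigma_finite : sigma_finite setT lebesgue_rV_succ.
Proof.
have /sigma_finiteP[F [TF ndF Foo]] := sigma_finiteT (@lebesgue_measure R).
have /sigma_finiteP[G [TG ndG Goo]] := sigma_finiteT m.
exists (fun k => [set x : 'rV[R]_n.+1 | F k (x ord0 ord0) /\
                          G k (\row_i x ord0 (lift ord0 i))]).
  apply/esym; rewrite -subTset => x _.
  have : [set: R] (x ord0 ord0) by [].
  rewrite TF => -[i _ Fi].
  have : setT (\row_(i < n) x ord0 (lift ord0 i)) by [].
  rewrite TG => -[j _ Gj].
  exists (maxn i j) => //; split.
    by move: Fi; apply/subsetPset/ndF/leq_maxl.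
  by move: Gj; apply/subsetPset/ndG/leq_maxr.
move=> k; have [mF Fk] := Foo k; have [mG Gk] := Goo k; split.
  exact: measurable_rV_succ.
by rewrite lebesgue_rV_succE// lte_mul_pinfty// ge0_fin_numE.
Qed.

HB.instance Definition _ := Measure_isSigmaFinite.Build _ _ _
  lebesgue_rV_succ succ_sigma_finite.

End lebesgue_rV_succ.

Fixpoint lebesgue_rV {R : realType} (n : nat) :
    {sigma_finite_measure set 'rV[R]_n -> \bar R} :=
  if n is k.+1 then lebesgue_rV_succ (lebesgue_rV k) else dirac (0 : 'rV[R]_0).

Lemma lebesgue_rV_box (R : realType) n (A : 'I_n -> set R) :
  (forall i, measurable (A i)) ->
  measurable [set x : 'rV[R]_n | forall i, A i (x ord0 i)] /\
  lebesgue_rV n [set x | forall i, A i (x ord0 i)] =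
  (\prod_(i < n) lebesgue_measure (A i))%E.
Proof.
elim: n A => [|n IH] A mA.
  have -> : [set x : 'rV[R]_0 | forall i, A i (x ord0 i)] = setT.
    by apply/seteqP; split => // x _ [].
  split; first exact: measurableT.
  by rewrite big_ord0 /= /dirac indicE mem_set => // -[].
have [mB HB] := IH (fun i => A (lift ord0 i)) (fun i => mA _).
have E : [set x : 'rV[R]_n.+1 | forall i, A i (x ord0 i)] =
  [set x | A ord0 (x ord0 ord0) /\
     [set y : 'rV[R]_n | forall i, A (lift ord0 i) (y ord0 i)]
       (\row_i x ord0 (lift ord0 i))].
  apply/seteqP; split=> x /=.
    by move=> H; split => // i; rewrite mxE.
  move=> [H0 H] i; case: (unliftP ord0 i) => [j|] -> //.
  by have := H j; rewrite mxE.
split; first by rewrite E; exact: measurable_rV_succ.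
rewrite big_ord_recl -HB -lebesgue_rV_succE//.
by congr (lebesgue_rV_succ _ _); exact: E.
Qed.

Lemma measurable_rV_open (R : realType) n (U : set 'rV[R]_n) :
  open U -> measurable U.
Proof.
move=> oU.
pose B (p : 'rV[rat]_n * nat) : set 'rV[R]_n :=
  [set y | forall i, ball (ratr (p.1 ord0 i) : R) p.2.+1%:R^-1 (y ord0 i)].
have mB p : measurable (B p).
  apply: (lebesgue_rV_box (A := fun i => ball (ratr (p.1 ord0 i) : R) _) _).1.
  by move=> i; apply: open_measurable; exact: ball_open.
pose F p := if `[< B p `<=` U >] then B p else set0.
rewrite (_ : U = \bigcup_p F p); last first.
  apply/seteqP; split=> [x Ux|x [p _]]; last first.
    by rewrite /F; case: asboolP => // BU Bx; exact: BU.
  move: oU; rewrite openE => /(_ _ Ux) /nbhs_ballP[e /= e0 xeU].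
  have [k _ ke] : exists2 k, True & (k.+1%:R^-1 < e / 2 :> R).
    have [k _ /(_ _ (leqnn k)) /= H] := near_infty_natSinv_lt (PosNum (divr_gt0 e0 (@ltr0n R 2))).
    by exists k.
  have k0 : 0 < k.+1%:R^-1 :> R by rewrite invr_gt0.
  have /choice[q qP] : forall i, exists q : rat,
      (ratr q : R) \in `](x ord0 i - k.+1%:R^-1), (x ord0 i + k.+1%:R^-1)[.
    by move=> i; apply: rat_in_itvoo; rewrite ltrBlDr -addrA ltrDl addr_gt0.
  exists (\row_i q i, k) => //; rewrite /F; case: asboolP => [_|[]].
    by move=> i /=; rewrite mxE /ball/= ltr_distl; have := qP i; rewrite in_itv.
  move=> y By; apply: xeU; split => // i j; rewrite [i]ord1 /ball/=.
  apply: le_lt_trans (ler_distD (ratr (q j)) _ _) _.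
  rewrite [ltRHS]splitr ltrD//; last first.
    by apply: lt_trans ke; have := By j; rewrite /ball/= mxE.
  by apply: lt_trans ke; rewrite distrC ltr_distl; have := qP j; rewrite in_itv.
apply: countable_bigcupT_measurable; first exact: countableP.
by move=> p; rewrite /F; case: ifP.
Qed.

Lemma measurable_rVE (R : realType) n :
  @measurable _ 'rV[R]_n = <<s open >>.
Proof.
apply/seteqP; split; last first.
  apply: smallest_sub; first exact: sigma_algebra_measurable.
  exact: measurable_rV_open.
apply: smallest_sub; first exact: smallest_sigma_algebra.
move=> A; rewrite -bigcup_seq/= => -[i _ [B mB <-]].
rewrite setTI.
have : preimage_set_system setT (@rV_coord R n i)
    (@RGenOInfty.G R).-sigma.-measurable `<=` <<s open >>.
  rewrite -g_sigma_preimageE.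
  apply: smallest_sub; first exact: smallest_sigma_algebra.
  move=> _ [_ [x ->] <-]; apply: sub_sigma_algebra; rewrite setTI.
  apply: open_comp; last exact: rray_open.
  by move=> y _; exact: coord_continuous.
by apply; exists B; [rewrite -RGenOInfty.measurableE | rewrite setTI].
Qed.

Section nonlocal_robin.
Context {R : realType} {d : nat}.
Local Notation Rd := 'rV[R]_d.
Local Notation mu := (@lebesgue_rV R d).

(* The norm `|x| provided by the library on 'rV[R]_n is the sup norm. *)
Definition enorm {n : nat} (x : 'rV[R]_n) : R :=
  Num.sqrt (\sum_(i < n) x ord0 i ^+ 2).

Definition eball (r : R) : set Rd := [set x | enorm x < r].

Definition boundary (A : set Rd) : set Rd := closure A `\` interior A.

(* Kernels live on R^d minus the origin (resp. off the diagonal): they are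
   represented by total functions, whose values there are unconstrained and do
   not contribute to the integrals below. *)
Definition levy_density (nu : Rd -> R) : Prop :=
  [/\ measurable_fun (~` [set (0 : Rd)%R]) nu,
      forall h, h != 0 -> 0 <= nu h,
      forall h, h != 0 -> nu (- h) = nu h &
      (\int[mu]_(h in ~` [set (0 : Rd)%R])
         (Num.min 1 (enorm h ^+ 2) * nu h)%:E < +oo)%E].

(* The support of the measure nu(h) dh. *)
Definition levy_support (nu : Rd -> R) : set Rd :=
  [set x | forall U : set Rd, open U -> U x ->
     (0 < \int[mu]_(h in U `\ (0 : Rd)%R) (nu h)%:E)%E].

Definition full_support (nu : Rd -> R) : Prop := levy_support nu = setT.

(* L^2(D, w(x) dx), on representatives. *)
Definition inL2 (D : set Rd) (w : Rd -> R) (f : Rd -> R) : Prop :=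
  measurable_fun D f /\ (\int[mu]_(x in D) (f x ^+ 2 * w x)%:E < +oo)%E.

Definition L2norm (D : set Rd) (w : Rd -> R) (f : Rd -> R) : R :=
  Num.sqrt (\int[mu]_(x in D) (f x ^+ 2 * w x)).

Definition quad_energy (nu : Rd -> R) (A D : set Rd) (u : Rd -> R) : \bar R :=
  (\int[mu]_(x in A) \int[mu]_(y in D) ((u x - u y) ^+ 2 * nu (x - y))%:E)%E.

Definition inH (nu : Rd -> R) (Omega : set Rd) (u : Rd -> R) : Prop :=
  inL2 Omega (cst 1) u /\ (quad_energy nu Omega Omega u < +oo)%E.

Definition Hnorm (nu : Rd -> R) (Omega : set Rd) (u : Rd -> R) : R :=
  Num.sqrt (L2norm Omega (cst 1) u ^+ 2 + fine (quad_energy nu Omega Omega u)).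

Definition inV (nu : Rd -> R) (Omega : set Rd) (u : Rd -> R) : Prop :=
  [/\ measurable_fun setT u, inL2 Omega (cst 1) u &
      (quad_energy nu Omega setT u < +oo)%E].

Definition Vnorm (nu : Rd -> R) (Omega : set Rd) (u : Rd -> R) : R :=
  Num.sqrt (L2norm Omega (cst 1) u ^+ 2 + fine (quad_energy nu Omega setT u)).

Definition ae_eq_on (D : set Rd) (u v : Rd -> R) : Prop :=
  {ae mu, forall x, D x -> u x = v x}.

Definition nu_tilde (nu : Rd -> R) (B : set Rd) (x : Rd) : R :=
  \int[mu]_(y in B) Num.min 1 (nu (x - y)).

Definition class_common (nu : Rd -> R) (Omega : set Rd) : Prop :=
  [/\ open Omega, bounded_set Omega, levy_density nu &
      (\int[mu]_(h in ~` [set (0 : Rd)%R]) (nu h)%:E = +oo)%E].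

(* The second conjunct says that E is well defined on a.e.-classes. *)
Definition class_A1 (nu : Rd -> R) (Omega : set Rd) : Prop :=
  class_common nu Omega /\
  exists (E : (Rd -> R) -> (Rd -> R)) (C : R),
    [/\ 0 < C,
        forall u v, inH nu Omega u -> inH nu Omega v ->
          ae_eq_on Omega u v -> ae_eq_on setT (E u) (E v) &
        forall u, inH nu Omega u ->
          [/\ inH nu setT (E u),
              Hnorm nu setT (E u) <= C * Hnorm nu Omega u &
              ae_eq_on Omega (E u) u]].

Definition radial (nu : Rd -> R) : Prop :=
  forall h h', h != 0 -> h' != 0 -> enorm h = enorm h' -> nu h = nu h'.

(* Near each boundary point, in coordinates x *m Q, Omega is the set of points
   lying strictly above the graph of a Lipschitz function of the coordinates
   other than the i-th. *)
Definition lipschitz_boundary (Omega : set Rd) : Prop :=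
  forall a, boundary Omega a ->
  exists (r : R) (Q : 'M[R]_d) (i : 'I_d) (gamma : 'rV[R]_d.-1 -> R) (L : R),
    [/\ 0 < r, Q *m Q^T = 1%:M,
        forall s t, `|gamma s - gamma t| <= L * enorm (s - t) &
        forall x, enorm (x - a) < r ->
          Omega x <-> gamma (col' i (x *m Q)) < (x *m Q) ord0 i].

Definition class_A2 (nu : Rd -> R) (Omega : set Rd) : Prop :=
  [/\ class_common nu Omega, lipschitz_boundary Omega, radial nu &
      (((delta ^- 2)%:E *
        \int[mu]_(h in eball delta `\ (0 : Rd)%R)
          (enorm h ^+ 2 * nu h)%:E)%E @[delta --> (0 : R)^'+] --> +oo%E)].

Definition inner_set (Omega : set Rd) (delta : R) : set Rd :=
  [set x | Omega x /\
     (delta%:E < ereal_inf [set (enorm (x - a))%:E | a in boundary Omega])%E].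

Definition class_A3 (nu : Rd -> R) (Omega : set Rd) : Prop :=
  class_common nu Omega /\
  ereal_inf [set (\int[mu]_(h in inner_set Omega delta) (nu (h - a))%:E)%E
            | a in boundary Omega] @[delta --> (0 : R)^'+] --> +oo%E.

Definition diagonal : set (Rd * Rd) := [set z | z.1 = z.2].

Definition elliptic_kernel (nu : Rd -> R) (Lambda : R) (k : Rd -> Rd -> R)
    : Prop :=
  [/\ measurable_fun (~` diagonal) (fun z => k z.1 z.2),
      forall x y, x != y -> 0 <= k x y,
      forall x y, x != y -> k x y = k y x &
      forall x y, x != y ->
        Lambda^-1 * nu (y - x) <= k x y <= Lambda * nu (y - x)].

Definition energy (k : Rd -> Rd -> R) (Omega : set Rd) (u v : Rd -> R) : R :=
  2^-1 * \int[(mu \x mu)%E]_(z in ~` ((~` Omega) `*` (~` Omega)))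
           ((u z.1 - u z.2) * (v z.1 - v z.2) * k z.1 z.2).

Definition robin_weak_solution (nu : Rd -> R) (k : Rd -> Rd -> R)
    (Omega : set Rd) (beta f g u : Rd -> R) : Prop :=
  inV nu Omega u /\
  forall v, inV nu Omega v ->
    energy k Omega u v + \int[mu]_(y in ~` Omega) (u y * v y * beta y) =
    \int[mu]_(x in Omega) (f x * v x) + \int[mu]_(y in ~` Omega) (g y * v y).

End nonlocal_robin.

(* Main.v *)
Require Import Defs.
From HB Require Import structures.
From mathcomp Require Import all_boot all_order all_algebra.
From mathcomp Require Import all_classical all_reals all_analysis.
From mathcomp Require Import measurable_realfun ring lra.

Set Implicit Arguments.
Unset Strict Implicit.
Unset Printing Implicit Defensive.

Import Order.TTheory GRing.Theory Num.Theory.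
Import numFieldNormedType.Exports.

Local Open Scope classical_set_scope.
Local Open Scope ring_scope.

(** The Robin problem is solved by minimising a quadratic functional, so
    everything rests on one inequality: the form
    a(u,u) = E(u,u) + int_{Omega^c} u^2 beta controls the full norm of V, with
    a constant that sees the kernel k only through Lambda.

    Coercivity.  Let m = min(1, nu), which is bounded and integrable.  Since
    u(x)^2 <= 2 (u(x) - u(y))^2 + 2 u(y)^2, integrating against m(x - y) for y
    in a set A shows that the L2 norm of u on A, together with the jump energy
    over Omega x R^d, controls the L2 norm of u on any bounded D inside Omega
    on which the convolution m * 1_A stays above a positive constant
    (transfer_control).  Two such steps lead from the boundary term to Omega.
    The term int u^2 beta controls u on a bounded set F of positive measure in
    Omega^c where beta is bounded below.  By Fubini and full support,
    m * 1_F is positive at some point of Omega, and as this convolution is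
    continuous it is bounded below on a small ball O inside Omega
    (kconv_locally_pos).  Finally m * 1_O is positive everywhere, again by
    full support, hence bounded below on the bounded set Omega by compactness
    (kconv_pos_uniform).  The outcome is friedrichs.  The continuity of m * 1_F
    comes from approximating F in L1 by Lipschitz functions
    (lip_approx_measurable).

    Boundedness.  The same elementary inequality, integrated the other way
    round, bounds int u^2 nu_tilde by the V norm (weighted_trace); this makes
    both the beta term and the functional v |-> int f v + int g v continuous
    on V.

    Existence.  The form domain is complete: the weight m * 1_B is positive on
    all of R^d, so a sequence that is Cauchy for the form is Cauchy in a
    weighted L2 space, a subsequence converges almost everywhere, and Fatou's
    lemma identifies the limit (form_domain_complete).  A minimising sequence
    is therefore convergent and its limit represents the functional
    (riesz_representation).  Uniqueness holds because a(h,h) = 0 forces the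
    weighted L2 norm of h to vanish, and the estimate follows from
    a(u,u) <= const (|f|^2 + |g|^2). *)

(** * Lebesgue measure on R^n: boxes and reflections *)

Lemma lebesgue_measure_reflect {R : realType} (c : R) (A : set R) :
  measurable A -> lebesgue_measure ((fun y => c - y) @^-1` A) = lebesgue_measure A.
Proof.
move=> mA.
have mf : measurable_fun [set: measurableTypeR R]
    ((fun y => c - y) : _ -> measurableTypeR R).
  exact: measurable_funB.
pose f : {mfun measurableTypeR R >-> measurableTypeR R} :=
  HB.pack (fun y => c - y : measurableTypeR R) (isMeasurableFun.Build _ _ _ _ _ mf).
apply/esym/(lebesgue_measure_unique (mu := pushforward lebesgue_measure f)) => //.
move=> _ [[a b]] _ <-.
have E : (fun y => c - y) @^-1` `]a, b] = `[(c - b), (c - a)[%classic :> set R.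
  by apply/seteqP; split => y /=; rewrite !in_itv/= => /andP[*]; apply/andP; split; lra.
transitivity (lebesgue_measure (`[(c - b), (c - a)[%classic : set R)); last first.
  by rewrite -E.
rewrite !lebesgue_measure_itv/= !lte_fin.
have -> : (c - b < c - a) = (a < b) by rewrite ltrD2l ltrN2.
by case: ifP => // _; rewrite -!EFinD; congr EFin; lra.
Qed.

Section lebesgue_rV_geometry.
Context {R : realType} {n : nat}.
Local Notation Rn := 'rV[R]_n.
Local Notation mu := (@lebesgue_rV R n).

(** The pi-system on which two measures are compared, through lebesgue_rV_box. *)
Definition boxes : set (set Rn) :=
  [set A | exists2 I : 'I_n -> set R, (forall i, measurable (I i)) &
           A = [set x : Rn | forall i, I i (x ord0 i)]].

Lemma boxes_setI : setI_closed boxes.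
Proof.
move=> _ _ [I mI ->] [J mJ ->]; exists (fun i => I i `&` J i).
  by move=> i; exact: measurableI.
apply/seteqP; split => x /= => [[h1 h2] i|h]; first by split.
by split => i; have [] := h i.
Qed.

Lemma measurable_boxes : @measurable _ Rn = <<s boxes >>.
Proof.
apply/seteqP; split; last first.
  apply: smallest_sub; first exact: sigma_algebra_measurable.
  by move=> _ [I mI ->]; exact: (lebesgue_rV_box mI).1.
apply: smallest_sub; first exact: smallest_sigma_algebra.
move=> A; rewrite -bigcup_seq/= => -[i _ [B mB <-]]; rewrite setTI.
apply: sub_sigma_algebra; exists (fun j => if j == i then B else setT).
  by move=> j; case: ifP.
apply/seteqP; split => x /= => [Bx j|]; last by move=> /(_ i); rewrite eqxx.
by case: eqVneq => // ->.
Qed.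

Definition cube (r : R) : set Rn := [set x : Rn | forall i, `[(- r), r]%classic (x ord0 i)].

Lemma measurable_cube r : measurable (cube r).
Proof. exact: (lebesgue_rV_box (A := fun=> `[(- r), r]%classic) _).1. Qed.

Lemma cube_lty r : (mu (cube r) < +oo)%E.
Proof.
rewrite (lebesgue_rV_box (A := fun=> `[(- r), r]%classic) _).2 => [|_]; last exact: measurable_itv.
have : (0 <= \prod_(i < n) lebesgue_measure (`[(- r)%R, r%R]%classic : set R) < +oo)%E.
  elim/big_ind : _ => [|x y /andP[x0 xoo] /andP[y0 yoo]|i _].
  - by rewrite lee01 ltry.
  - by rewrite mule_ge0//= lte_mul_pinfty// ge0_fin_numE.
  - by rewrite measure_ge0/= lebesgue_measure_itv/=; case: ifP => // _; exact: ltry.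
by case/andP.
Qed.

Lemma bigcup_cube : \bigcup_k cube k%:R = setT.
Proof.
rewrite -subTset => x _.
have [k xk] : exists k : nat, forall i, `|x ord0 i| <= k%:R.
  exists (\max_(i < n) Num.truncn `|x ord0 i|).+1 => i.
  rewrite ltW// (lt_le_trans (truncnS_gt _))// ler_nat ltnS.
  exact: (@leq_bigmax _ (fun i => Num.truncn `|x ord0 i|)).
by exists k => // i /=; rewrite in_itv/= -ler_norml.
Qed.

Lemma measurable_rV_sub :
  measurable_fun setT (fun z : Rn * Rn => z.1 - z.2).
Proof.
apply/measurable_fun_rVP => i; under eq_fun do rewrite !mxE.
apply: measurable_funB.
- exact: measurableT_comp (@measurable_rV_coord R n i) measurable_fst.
- exact: measurableT_comp (@measurable_rV_coord R n i) measurable_snd.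
Qed.

Lemma measurable_rV_reflect (x : Rn) : measurable_fun setT (fun y : Rn => x - y).
Proof. exact: measurableT_comp measurable_rV_sub (pair1_measurable x). Qed.

Lemma lebesgue_rV_reflect (x : Rn) (A : set Rn) : measurable A ->
  mu ((fun y => x - y) @^-1` A) = mu A.
Proof.
move=> mA.
pose f : {mfun Rn >-> Rn} :=
  HB.pack (fun y : Rn => x - y) (isMeasurableFun.Build _ _ _ _ _ (measurable_rV_reflect x)).
apply/esym.
apply: (@measure_unique _ _ _ boxes (fun k => cube k%:R) measurable_boxes boxes_setI
  _ bigcup_cube mu (pushforward mu f)) => //; last by move=> k; exact: cube_lty.
- by move=> k; exists (fun=> `[(- k%:R), k%:R]%classic).
- move=> _ [I mI ->].
  have mJ i : measurable ((fun y => x ord0 i - y) @^-1` (I i)).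
    rewrite -[X in measurable X]setTI.
    by have := mI i; apply: measurable_funB.
  transitivity (mu [set y : Rn | forall i, ((fun y => x ord0 i - y) @^-1` (I i)) (y ord0 i)]).
    apply: etrans (lebesgue_rV_box mI).2 _; apply/esym.
    apply: etrans (lebesgue_rV_box mJ).2 _.
    by apply: eq_bigr => i _; rewrite lebesgue_measure_reflect.
  rewrite /pushforward; congr (mu _); apply/seteqP.
  by split => y /= h i; have := h i; rewrite !mxE.
Qed.

(** The only change of variables that convolutions need: the kernels below are
    even, so translations are compositions of reflections y |-> x - y. *)
Lemma ge0_integral_reflect (x : Rn) (D : set Rn) (f : Rn -> \bar R) : measurable D ->
  measurable_fun setT f -> (forall y, 0 <= f y)%E ->
  (\int[mu]_(y in (fun y => (x - y)%R) @^-1` D) f (x - y)%R = \int[mu]_(y in D) f y)%E.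
Proof.
move=> mD mf f0.
rewrite -(ge0_integral_pushforward (measurable_rV_reflect x) mu mD (f := f)) //; last first.
  exact: measurable_funS mf.
apply: eq_measure_integral; first exact: measurable_rV_reflect.
by move=> ? A mA _; exact: lebesgue_rV_reflect.
Qed.

End lebesgue_rV_geometry.

(** * Approximation in L1 by Lipschitz functions *)

Section lipschitz_approximation.
Context {R : realType} {n : nat}.
Local Notation Rn := 'rV[R]_n.
Local Notation mu := (@lebesgue_rV R n).

Definition lipschitz_fun (L : R) (h : Rn -> R) :=
  forall x y, `|h x - h y| <= L * `|x - y|.

Lemma measurable_lipschitz (L : R) (h : Rn -> R) :
  lipschitz_fun L h -> measurable_fun setT h.
Proof.
move=> hL; have ch : continuous h.
  move=> x; apply/(@cvgrPdist_le _ _ _ (nbhs x)) => /= e e0.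
  have L0 : 0 < `|L| + 1 by rewrite ltr_wpDl.
  apply/nbhs_ballP; exists (e / (`|L| + 1)); first exact: divr_gt0.
  move=> y; rewrite -ball_normE /= => /ltW xy; rewrite (le_trans (hL _ _))//.
  rewrite (le_trans (ler_norm _))// normrM normr_id.
  rewrite (@le_trans _ _ ((`|L| + 1) * (e / (`|L| + 1))))//.
    by rewrite ler_pM// lerDl.
  by rewrite mulrC divfK// gt_eqF.
apply: (measurability _ (RGenOInfty.measurableE R)) => _ [_ [x ->] <-].
rewrite setTI; by apply: measurable_rV_open; apply: open_comp => //; exact: rray_open.
Qed.

(** Membership in the L1-closure of the Lipschitz functions, where only the
    differences are integrated. *)
Definition lip_approx (f : Rn -> R) := measurable_fun setT f /\
  forall e : R, 0 < e -> exists2 h : Rn -> R, (exists L, lipschitz_fun L h) &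
    (\int[mu]_y `|f y - h y|%:E <= e%:E)%E.

Let int_norm_triangle (f g k : Rn -> R) :
  measurable_fun setT f -> measurable_fun setT g -> measurable_fun setT k ->
  (forall y, `|k y| <= `|f y| + `|g y|) ->
  (\int[mu]_y `|k y|%:E <= \int[mu]_y `|f y|%:E + \int[mu]_y `|g y|%:E)%E.
Proof.
move=> mf mg mk kfg.
have m1 (f' : Rn -> R) : measurable_fun setT f' -> measurable_fun setT (fun y => `|f' y|%:E).
  by move=> mf'; apply/measurable_EFinP/measurableT_comp.
rewrite -ge0_integralD//=; [|exact: m1..].
apply: ge0_le_integral => //=; first exact: m1.
  by apply: emeasurable_funD; exact: m1.
by move=> y _; rewrite -EFinD lee_fin.
Qed.

Lemma lip_approx_lim (f : Rn -> R) : measurable_fun setT f ->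
  (forall e : R, 0 < e -> exists2 g : Rn -> R, lip_approx g &
    (\int[mu]_y `|f y - g y|%:E <= e%:E)%E) -> lip_approx f.
Proof.
move=> mf H; split => // e e0.
have e2 : 0 < e / 2 by exact: divr_gt0.
have [g [mg gapx] fg] := H _ e2; have [h [L hL] gh] := gapx _ e2.
exists h; first by exists L.
have mh := measurable_lipschitz hL.
rewrite (splitr e) EFinD; apply: le_trans (leeD fg gh).
apply: int_norm_triangle; [exact: measurable_funB..|].
by move=> y; rewrite -(subrKA (g y)) ler_normD.
Qed.

Lemma lip_approxD (f g : Rn -> R) : lip_approx f -> lip_approx g ->
  lip_approx (fun y => f y + g y).
Proof.
move=> [mf af] [mg ag]; split; first exact: measurable_funD.
move=> e e0; have e2 : 0 < e / 2 by exact: divr_gt0.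
have [h [L hL] fh] := af _ e2; have [k [M kM] gk] := ag _ e2.
exists (fun y => h y + k y).
  exists (L + M) => x y; rewrite opprD addrACA (le_trans (ler_normD _ _))//.
  by rewrite mulrDl lerD.
have mh := measurable_lipschitz hL; have mk := measurable_lipschitz kM.
rewrite (splitr e) EFinD; apply: le_trans (leeD fh gk).
apply: int_norm_triangle; [exact: measurable_funB..| |].
  by apply: measurable_funB; exact: measurable_funD.
by move=> y; rewrite opprD addrACA ler_normD.
Qed.

Lemma lip_approxN (f : Rn -> R) : lip_approx f -> lip_approx (fun y => - f y).
Proof.
move=> [mf af]; split; first exact: measurableT_comp.
move=> e e0; have [h [L hL] fh] := af _ e0.
exists (fun y => - h y); first by exists L => x y; rewrite -opprD normrN.
by under eq_integral do rewrite -opprD normrN.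
Qed.

Lemma nonincreasing_mu_small (W : (set Rn)^nat) (e : R) : 0 < e ->
  (mu (W 0%N) < +oo)%E -> (forall k, measurable (W k)) ->
  {homo W : k m / (k <= m)%N >-> (m <= k)%O} -> \bigcap_k W k = set0 ->
  exists k, (mu (W k) <= e%:E)%E.
Proof.
move=> e0 W0 mW ndW capW.
have : (mu \o W) x @[x --> \oo] --> 0%:E.
  have := @nonincreasing_cvg_mu _ _ _ mu W W0 mW.
  by rewrite capW measure0; apply.
move=> /fine_cvgP[fW] /cvgr0Pnorm_lt /(_ _ e0) /= H.
have [k] := @filter_ex _ \oo _ _ (filterI fW H).
move=> [/= fk /ltW]; rewrite ger0_norm ?fine_ge0// => fke; exists k.
by rewrite -(fineK fk) lee_fin.
Qed.

Section inf_convolution.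
Variables (V : set Rn) (oV : open V).

(** The inf-convolution of the indicator of V with k times the norm: the largest
    k-Lipschitz minorant of \1_V.  It is defined without a case distinction on
    whether V is the whole space, unlike the distance to the complement. *)
Definition inf_conv (k : nat) (y : Rn) : R :=
  inf [set \1_V z + k%:R * `|y - z| | z in setT].

Let has_lb k y : has_lbound [set \1_V z + k%:R * `|y - z| | z in setT].
Proof. by exists 0 => _ [z _ <-]; rewrite addr_ge0// mulr_ge0. Qed.

Let inf_conv_le k y z : inf_conv k y <= \1_V z + k%:R * `|y - z|.
Proof. by apply: ge_inf; [exact: has_lb|exists z]. Qed.

Let le_inf_conv k y (c : R) : (forall z, c <= \1_V z + k%:R * `|y - z|) ->
  c <= inf_conv k y.
Proof.
move=> H; apply: lb_le_inf; first by exists (\1_V y + k%:R * `|y - y|), y.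
by move=> _ [z _ <-]; exact: H.
Qed.

Lemma inf_conv_ge0 k y : 0 <= inf_conv k y.
Proof. by apply: le_inf_conv => z; rewrite addr_ge0// mulr_ge0. Qed.

Lemma inf_conv_le_indic k y : inf_conv k y <= \1_V y.
Proof. by have := inf_conv_le k y y; rewrite subrr normr0 mulr0 addr0. Qed.

Lemma lipschitz_inf_conv k : lipschitz_fun k%:R (inf_conv k).
Proof.
have H x y : inf_conv k x - inf_conv k y <= k%:R * `|x - y|.
  rewrite lerBlDl addrC -lerBlDl; apply: le_inf_conv => z.
  rewrite lerBlDl (le_trans (inf_conv_le _ _ z))// addrCA lerD2l -mulrDr.
  by rewrite ler_wpM2l// ler_distD.
by move=> x y; rewrite ler_norml lerNl opprB {1}distrC !H.
Qed.

Lemma inf_conv_ndecr k m y : (k <= m)%N -> inf_conv k y <= inf_conv m y.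
Proof.
move=> km; apply: le_inf_conv => z; apply: le_trans (inf_conv_le _ _ z) _.
by rewrite lerD2l ler_wpM2r// ler_nat.
Qed.

(** With ball(y, e) inside V, every z is either in V or at distance at least e
    from y, so any k >= 1/e works. *)
Lemma inf_conv_eventually y : V y -> exists k, 1 <= inf_conv k y.
Proof.
move=> Vy; move: oV; rewrite openE => /(_ _ Vy) /nbhs_ballP[e /= e0 eV].
exists (Num.truncn e^-1).+1; apply: le_inf_conv => z.
have [Vz|nVz] := pselect (V z).
  by rewrite indicE mem_set//= lerDl mulr_ge0.
rewrite indicE memNset//= add0r.
have : e <= `|y - z|.
  by rewrite leNgt; apply/negP => yz; apply: nVz; apply: eV; rewrite -ball_normE.
move=> /(ler_pM _ _ (ltW (truncnS_gt e^-1))); rewrite mulVf ?gt_eqF//.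
by apply; rewrite ?invr_ge0 ltW.
Qed.

(** \1_V - inf_conv k is at most 1 and lives on the points of V where
    inf_conv k < 1, a decreasing family of sets with empty intersection. *)
Lemma lip_approx_open : (mu V < +oo)%E -> lip_approx (\1_V : Rn -> R).
Proof.
move=> Voo; have mV := measurable_rV_open oV.
split; first exact: measurable_indic.
move=> e e0.
have mh k := measurable_lipschitz (@lipschitz_inf_conv k).
pose W k := V `&` [set y | inf_conv k y < 1].
have mW k : measurable (W k).
  apply: measurableI => //; rewrite -[X in measurable X]setTI.
  exact: measurable_fun_ltr.
have [k Wk] : exists k, (mu (W k) <= e%:E)%E.
  apply: nonincreasing_mu_small => //.
  - by rewrite (le_lt_trans _ Voo)// le_measure ?inE//; exact: subIsetl.
  - move=> k m km; apply/subsetPset => y [Vy] /=.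
    by split => //=; apply: le_lt_trans (inf_conv_ndecr _ km) _.
  - apply/seteqP; split => // y Wy.
    have [Vy _] := Wy 0%N I; have [k] := inf_conv_eventually Vy.
    by have [_ /=] := Wy k I; rewrite ltNge => /negP.
exists (inf_conv k); first by exists k%:R; exact: lipschitz_inf_conv.
apply: (@le_trans _ _ (\int[mu]_y (\1_(W k) y)%:E)%E); last first.
  by rewrite integral_indic// setIT.
apply: ge0_le_integral => //=.
- by apply/measurable_EFinP/measurableT_comp => //; apply: measurable_funB.
- by apply/measurable_EFinP/measurable_indic.
move=> y _; rewrite lee_fin ger0_norm ?subr_ge0 ?inf_conv_le_indic//.
rewrite !indicE; have [/set_mem Vy|/negP nVy] := boolP (y \in V).
  have [h1|h1] := ltP (inf_conv k y) 1.
    by rewrite (mem_set (A := W k))//= gerBl inf_conv_ge0.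
  by rewrite memNset/= ?subr_le0// => -[_]/=; rewrite ltNge h1.
rewrite memNset/= ?sub0r ?oppr_le0 ?inf_conv_ge0//.
by move=> [/mem_set].
Qed.

End inf_convolution.

(** Dynkin induction from the open sets.  Cutting with a ball keeps all measures
    finite, which makes the tails of disjoint unions small. *)
Lemma lip_approx_measurable (r : R) (A : set Rn) : measurable A ->
  lip_approx (\1_(A `&` ball (0 : Rn) r) : Rn -> R).
Proof.
move=> mA.
set Z := ball (0 : Rn) r.
have oZ : open Z by apply: ball_open.
have mZ := measurable_rV_open oZ.
have Zoo : (mu Z < +oo)%E.
  apply: le_lt_trans (cube_lty (n := n) r); apply: le_measure; rewrite ?inE//.
    exact: measurable_cube.
  move=> y [r0 /(_ ord0) yr] i /=.
  by rewrite in_itv/= -ler_norml; have := yr i; rewrite /ball/= mxE sub0r normrN => /ltW.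
pose P (B : set Rn) := lip_approx (\1_(B `&` Z) : Rn -> R).
have indicB (B C : set Rn) : B `<=` C ->
    \1_(C `\` B) = (fun y => \1_C y - \1_B y) :> (Rn -> R).
  move=> BC; apply/funext => y; rewrite !indicE.
  have [By|nBy] := pselect (B y).
    by rewrite memNset/= ?mem_set ?subrr//=; [exact: BC|case].
  rewrite (memNset nBy) subr0; congr (_%:R); apply: congr1.
  by apply/idP/idP => /set_mem; [case=> Cy _; exact/mem_set|move=> Cy; apply/mem_set].
have open_setI : setI_closed (@open Rn) by move=> B C; exact: openI.
apply: (@dynkin_induction _ _ (@open Rn) P) => //.
- exact: measurable_rVE.
- by rewrite /P setTI; exact: lip_approx_open.
- move=> U oU; apply: lip_approx_open; first exact: openI.
  by rewrite (le_lt_trans _ Zoo)// le_measure ?inE//; apply: measurableI => //; exact: measurable_rV_open.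
- move=> B mB PB; rewrite /P (_ : ~` B `&` Z = Z `\` (B `&` Z)).
    rewrite indicB//; apply: lip_approxD; first exact: lip_approx_open.
    exact: lip_approxN.
  apply/seteqP; split => [y [nB Zy]|y [Zy nBZ]]; split => //; first by case.
  by move=> By; apply: nBZ.
- move=> F mF tF PF.
  pose S k := \bigcup_(i < k) F i.
  have mS k : measurable (S k) by apply: bigcup_measurable.
  have SS k : S k.+1 = S k `|` F k by rewrite /S bigcup_mkord big_ord_recr /= -bigcup_mkord.
  have PS k : P (S k).
    elim: k => [|k IHk].
      by rewrite /P /S bigcup_mkord big_ord0 set0I; apply: lip_approx_open; rewrite ?measure0 //; exact: open0.
    have -> : P (S k.+1) = lip_approx (fun y => \1_(S k `&` Z) y + \1_(F k `&` Z) y : R).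
      congr lip_approx; apply/funext => y; rewrite SS setIUl !indicE in_setU.
      have [/set_mem[[i /= ik Fi] _]|_] := boolP (y \in S k `&` Z); last by rewrite add0r.
      rewrite memNset ?addr0// => -[Fk _].
      have ik' : i != k by rewrite neq_ltn ik.
      by move/trivIsetP : tF => /(_ i k I I ik') /seteqP[/(_ y) + _]; apply; split.
    by apply: lip_approxD; [exact: IHk|exact: PF].
  have mU : measurable (\bigcup_k F k) by exact: bigcup_measurable.
  apply: lip_approx_lim; first by apply: measurable_indic; exact: measurableI.
  move=> e e0.
  pose W k := (\bigcup_k F k `&` Z) `\` (S k `&` Z).
  have mW k : measurable (W k) by apply: measurableD; exact: measurableI.
  have SU k : S k `&` Z `<=` \bigcup_k F k `&` Z by move=> y [[i _ Fi] Zy]; split => //; exists i.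
  have [k Wk] : exists k, (mu (W k) <= e%:E)%E.
    apply: nonincreasing_mu_small => //.
    + by rewrite (le_lt_trans _ Zoo)// le_measure ?inE// => y [[]].
    + move=> k m km; apply/subsetPset => y [Uy nSy]; split => // -[[i ik Fi] Zy].
      by apply: nSy; split => //; exists i => //=; exact: leq_trans km.
    + apply/seteqP; split => // y Wy; have [[[i _ Fi] Zy] _] := Wy 0%N I.
      by have [_] := Wy i.+1 I; apply; split => //; exists i => /=.
  exists (\1_(S k `&` Z)); first exact: PS.
  apply: le_trans Wk; rewrite -[X in (_ <= mu X)%E]setIT -integral_indic//.
  rewrite le_eqVlt; apply/orP; left; apply/eqP; apply: eq_integral => y _.
  by have /(congr1 (@^~ y)) /= <- := indicB _ _ (SU k); rewrite ger0_norm.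
- by rewrite -measurable_rVE.
Qed.

End lipschitz_approximation.

(** * Iterated integrals over product domains *)

Section product_domains.
Context d1 d2 (T1 : measurableType d1) (T2 : measurableType d2) (R : realType).
Variables (m1 : {sigma_finite_measure set T1 -> \bar R})
          (m2 : {sigma_finite_measure set T2 -> \bar R}).
Local Open Scope ereal_scope.

Let patchX (D1 : set T1) (D2 : set T2) (f : T1 * T2 -> \bar R) x y :
  (f \_ (D1 `*` D2)) (x, y) = ((fun x => ((fun y => f (x, y)) \_ D2) y) \_ D1) x.
Proof.
rewrite /patch /= in_setX /=.
by case: (x \in D1) => //=; case: (y \in D2).
Qed.

Variable (f : T1 * T2 -> \bar R).
Hypotheses (mf : measurable_fun setT f) (f0 : forall z, 0 <= f z).

Lemma measurable_fun_integral_dom (D2 : set T2) : measurable D2 ->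
  measurable_fun setT (fun x => \int[m2]_(y in D2) f (x, y)).
Proof.
move=> mD2.
under eq_fun do rewrite integral_mkcond.
have E x : (fun y => f (x, y)) \_ D2 = fun y => (f \_ (setT `*` D2)) (x, y).
  by apply/funext => y; rewrite patchX /patch in_setT.
under eq_fun do rewrite E.
apply: measurable_fun_fubini_tonelli_F.
  apply/(measurable_restrictT _ _).1; first exact: measurableX.
  exact: measurable_funS mf.
by move=> z; rewrite /patch; case: ifP.
Qed.

Lemma tonelli_setX (D1 : set T1) (D2 : set T2) : measurable D1 -> measurable D2 ->
  \int[m1 \x m2]_(z in D1 `*` D2) f z = \int[m1]_(x in D1) \int[m2]_(y in D2) f (x, y).
Proof.
move=> mD1 mD2.
rewrite integral_mkcond fubini_tonelli1; last 2 first.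
  apply/(measurable_restrictT _ _).1; first exact: measurableX.
  exact: measurable_funS mf.
  by move=> z; rewrite /patch; case: ifP.
rewrite [RHS]integral_mkcond; apply: eq_integral => x _.
rewrite /fubini_F /=; under eq_integral do rewrite patchX.
rewrite [RHS]/patch; case: ifPn => xD.
  by rewrite [RHS]integral_mkcond; apply: eq_integral => y _; rewrite {1}/patch xD.
by rewrite integral0_eq// => y _; rewrite {1}/patch (negbTE xD).
Qed.

Lemma tonelli_setX_swap (D1 : set T1) (D2 : set T2) : measurable D1 -> measurable D2 ->
  \int[m1]_(x in D1) \int[m2]_(y in D2) f (x, y) =
  \int[m2]_(y in D2) \int[m1]_(x in D1) f (x, y).
Proof.
move=> mD1 mD2.
rewrite -tonelli_setX// integral_mkcond fubini_tonelli2; last 2 first.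
  apply/(measurable_restrictT _ _).1; first exact: measurableX.
  exact: measurable_funS mf.
  by move=> z; rewrite /patch; case: ifP.
rewrite [RHS]integral_mkcond; apply: eq_integral => y _.
rewrite /fubini_G /=; under eq_integral do rewrite patchX.
rewrite [RHS]/patch; case: ifPn => yD.
  by rewrite [RHS]integral_mkcond; apply: eq_integral => x _; rewrite /patch yD.
by rewrite integral0_eq// => x _; rewrite /patch (negbTE yD); case: ifP.
Qed.

End product_domains.

(** * Convolution of an indicator with an integrable kernel *)

Section kernel_convolution.
Context {R : realType} {d : nat}.
Local Notation Rd := 'rV[R]_d.
Local Notation mu := (@lebesgue_rV R d).
Variable m : Rd -> R.
Hypotheses (mm : measurable_fun setT m) (m_ge0 : forall h, 0 <= m h)
  (m_le1 : forall h, m h <= 1)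
  (m_fin : (\int[mu]_h (m h)%:E < +oo)%E)
  (m_pos : forall U : set Rd, open U -> U !=set0 -> (0 < \int[mu]_(h in U) (m h)%:E)%E).

Definition kconv (A : set Rd) (x : Rd) : \bar R :=
  (\int[mu]_(y in A) (m (x - y))%:E)%E.

Lemma measurable_kernel_sub (K : Rd -> R) : measurable_fun setT K ->
  measurable_fun setT (fun z : Rd * Rd => K (z.1 - z.2)).
Proof. by move=> mK; exact: measurableT_comp mK measurable_rV_sub. Qed.

Lemma measurable_kernel_reflect (K : Rd -> R) (x : Rd) : measurable_fun setT K ->
  measurable_fun setT (fun y : Rd => K (x - y)).
Proof. by move=> mK; exact: measurableT_comp mK (measurable_rV_reflect x). Qed.

Lemma integral_kernel_reflect (x : Rd) :
  (\int[mu]_y (m (x - y))%:E = \int[mu]_h (m h)%:E)%E.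
Proof.
rewrite -(ge0_integral_reflect x (f := EFin \o m) measurableT) //.
exact/measurable_EFinP.
Qed.

Lemma kconvE (A : set Rd) (x : Rd) : measurable A ->
  (kconv A x = \int[mu]_z (\1_A (x - z) * m z)%:E)%E.
Proof.
move=> mA; rewrite /kconv integral_mkcond.
have mg : measurable_fun setT (fun z : Rd => (\1_A (x - z) * m z)%:E).
  apply/measurable_EFinP/measurable_funM => //.
  by apply: measurable_kernel_reflect; exact: measurable_indic.
have g0 z : (0 <= (\1_A (x - z) * m z)%:E)%E by rewrite lee_fin mulr_ge0.
rewrite -(ge0_integral_reflect x measurableT mg g0); apply: eq_integral => y _.
rewrite opprB addrC subrK /patch indicE.
by case: (y \in A); rewrite ?mul1r ?mul0r.
Qed.

Lemma kconv_ge0 (A : set Rd) (x : Rd) : (0 <= kconv A x)%E.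
Proof. by apply: integral_ge0 => y _; rewrite lee_fin. Qed.

Lemma kconv_le (A : set Rd) (x : Rd) : measurable A ->
  (kconv A x <= \int[mu]_h (m h)%:E)%E.
Proof.
move=> mA; rewrite -(integral_kernel_reflect x); apply: ge0_subset_integral => //.
- by apply/measurable_EFinP; exact: measurable_kernel_reflect.
- by move=> y _; rewrite lee_fin.
Qed.

(** In m * 1_A replace 1_A by a Lipschitz function h that is close in L1: since
    m <= 1 the error is small uniformly in x, and m * h is Lipschitz because m
    is integrable.  Working with inequalities between nonnegative integrals
    avoids asking for the integrability of h. *)
Lemma kconv_locally_pos (A : set Rd) (r : R) (x0 : Rd) : measurable A ->
  A `<=` ball (0 : Rd) r -> (0 < kconv A x0)%E ->
  exists c : R, 0 < c /\ \forall x \near x0, (c%:E <= kconv A x)%E.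
Proof.
move=> mA Ar A0.
have Mfin : (\int[mu]_h (m h)%:E \is a fin_num)%E.
  by rewrite ge0_fin_numE// integral_ge0// => h _; rewrite lee_fin.
set M := fine (\int[mu]_h (m h)%:E)%E.
have M0 : 0 <= M by rewrite fine_ge0// integral_ge0// => h _; rewrite lee_fin.
have afin : kconv A x0 \is a fin_num.
  by rewrite ge0_fin_numE ?kconv_ge0// (le_lt_trans (kconv_le _ _)).
set a := fine (kconv A x0).
have a0 : 0 < a by rewrite fine_gt0// A0 -ge0_fin_numE ?kconv_ge0.
have a8 : 0 < a / 8 by exact: divr_gt0.
(* Budget: a/8 for each of the two replacements of 1_A by h and a/4 for the
   displacement of h, which leaves a/2 of the value a at x0. *)
have [_ /(_ _ a8)[h [L hL] Ah]] := lip_approx_measurable r mA.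
have mh := measurable_lipschitz hL.
rewrite (setIidl Ar) in Ah.
pose D := 4 * (`|L| * M + 1).
have D0 : 0 < D by rewrite mulr_gt0// ltr_wpDl// mulr_ge0.
exists (a / 2); split; first exact: divr_gt0.
apply/nbhs_ballP; exists (a / D); first exact: divr_gt0.
move=> x; rewrite -ball_normE /= => xx0.
have mA' y : measurable_fun setT (fun z : Rd => \1_A (y - z) : R).
  by apply: measurable_kernel_reflect; exact: measurable_indic.
have mh' y : measurable_fun setT (fun z : Rd => h (y - z)).
  exact: measurable_kernel_reflect.
have mB (f g : Rd -> R) : measurable_fun setT f -> measurable_fun setT g ->
    measurable_fun setT (fun z : Rd => (`|f z - g z| * m z)%:E).
  move=> mf mg; apply/measurable_EFinP/measurable_funM => //.
  by apply: measurableT_comp => //; exact: measurable_funB.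
have Bge0 (f g : Rd -> R) z : (0 <= (`|f z - g z| * m z)%:E)%E.
  by rewrite lee_fin mulr_ge0.
have small y : (\int[mu]_z (`|\1_A (y - z) - h (y - z)| * m z)%:E <= (a / 8)%:E)%E.
  apply: le_trans Ah.
  have mg : measurable_fun setT (fun z : Rd => `|\1_A z - h z|%:E).
    apply/measurable_EFinP/measurableT_comp => //.
    by apply: measurable_funB => //; exact: measurable_indic.
  rewrite -(ge0_integral_reflect y measurableT mg)//.
  apply: ge0_le_integral => //=.
  - by move=> z _; rewrite lee_fin mulr_ge0.
  - exact: (mB (fun z => \1_A (y - z)) (fun z => h (y - z))).
  - apply/measurable_EFinP.
    apply: (measurable_kernel_reflect y (K := fun z => `|\1_A z - h z|)).
    exact/measurable_EFinP.
  - by move=> z _; rewrite lee_fin ler_piMr.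
have hxx0 : (\int[mu]_z (`|h (x0 - z) - h (x - z)| * m z)%:E <= (a / 4)%:E)%E.
  apply: (@le_trans _ _ (\int[mu]_z ((`|L| * (a / D))%:E * (m z)%:E))%E).
    apply: ge0_le_integral => //=.
    - by move=> z _; rewrite lee_fin mulr_ge0.
    - exact: (mB (fun z => h (x0 - z)) (fun z => h (x - z))).
    - by apply: emeasurable_funM => //; exact/measurable_EFinP.
    - move=> z _; rewrite lee_fin ler_wpM2r// (le_trans (hL _ _))//.
      rewrite opprB addrA subrK (le_trans (ler_norm _))// normrM normr_id.
      by rewrite ler_wpM2l// ltW.
  rewrite ge0_integralZl_EFin//; last 3 first.
  - by move=> z _; rewrite lee_fin.
  - exact/measurable_EFinP.
  - by rewrite mulr_ge0// divr_ge0// ltW.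
  rewrite -(fineK Mfin) -/M -EFinM lee_fin mulrAC mulrA ler_pdivrMr// /D.
  have := ltW a0; nra.
have mI (y : Rd) : measurable_fun setT (fun z : Rd => (\1_A (y - z) * m z)%:E).
  by apply/measurable_EFinP/measurable_funM.
have Ige0 (y z : Rd) : (0 <= (\1_A (y - z) * m z)%:E)%E by rewrite lee_fin mulr_ge0.
pose f1 (z : Rd) := (`|\1_A (x0 - z) - h (x0 - z)| * m z)%:E.
pose f2 (z : Rd) := (`|h (x0 - z) - h (x - z)| * m z)%:E.
pose f3 (z : Rd) := (`|\1_A (x - z) - h (x - z)| * m z)%:E.
have mf1 : measurable_fun setT f1.
  exact: (mB (fun z => \1_A (x0 - z)) (fun z => h (x0 - z))).
have mf2 : measurable_fun setT f2.
  exact: (mB (fun z => h (x0 - z)) (fun z => h (x - z))).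
have mf3 : measurable_fun setT f3.
  exact: (mB (fun z => \1_A (x - z)) (fun z => h (x - z))).
have m12 := emeasurable_funD mf1 mf2.
have m123 := emeasurable_funD m12 mf3.
have : (kconv A x0 <= \int[mu]_z f1 z + \int[mu]_z f2 z + \int[mu]_z f3 z + kconv A x)%E.
  rewrite !kconvE//.
  have f10 z : (0 <= f1 z)%E by rewrite lee_fin mulr_ge0.
  have f20 z : (0 <= f2 z)%E by rewrite lee_fin mulr_ge0.
  have f30 z : (0 <= f3 z)%E by rewrite lee_fin mulr_ge0.
  rewrite -ge0_integralD// -ge0_integralD//; last by move=> z _; exact: adde_ge0.
  rewrite -ge0_integralD//; last by move=> z _; rewrite !adde_ge0.
  apply: ge0_le_integral => //=; first exact: (emeasurable_funD m123 (mI x)).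
  move=> z _; rewrite /f1 /f2 /f3 -!EFinD lee_fin -!mulrDl ler_wpM2r//.
  have := ler_norm (\1_A (x0 - z) - h (x0 - z)).
  have := ler_norm (h (x0 - z) - h (x - z)).
  have := ler_norm (- (\1_A (x - z) - h (x - z))).
  rewrite normrN.
  lra.
have xfin : kconv A x \is a fin_num.
  by rewrite ge0_fin_numE ?kconv_ge0// (le_lt_trans (kconv_le _ _)).
move=> /le_trans/(_ (leeD (leeD (leeD (small x0) hxx0) (small x)) (lexx _))).
rewrite -(fineK xfin) -(fineK afin) -/a -!EFinD !lee_fin; lra.
Qed.

Lemma kconv_open_pos (O : set Rd) (x : Rd) : open O -> O !=set0 -> (0 < kconv O x)%E.
Proof.
move=> oO [y0 Oy0]; have mO := measurable_rV_open oO.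
pose U := (fun y : Rd => x - y) @^-1` O.
have oU : open U.
  apply: open_comp => // y _; apply: continuousB; [exact: cst_continuous|exact: cvg_id].
have U0 : U !=set0 by exists (x - y0); rewrite /U /= opprB addrC subrK.
apply: lt_le_trans (m_pos oU U0) _.
rewrite kconvE//.
rewrite integral_mkcond; apply: ge0_le_integral => //=.
- by move=> z _; rewrite /patch; case: ifP => // _; rewrite lee_fin.
- apply/(measurable_restrictT _ _).1; first exact: measurable_rV_open.
  by apply: measurable_funTS; exact/measurable_EFinP.
- apply/measurable_EFinP/measurable_funM => //.
  by apply: measurable_kernel_reflect; exact: measurable_indic.
- move=> z _; rewrite /patch; case: ifPn => [/set_mem Uz|_].
    by rewrite indicE mem_set// mul1r.
  by rewrite lee_fin mulr_ge0.
Qed.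

(** Positivity everywhere becomes a uniform lower bound by compactness.  The
    filter of small positive c indexes the covering argument: a local bound by c0
    is a local bound by every smaller c. *)
Lemma kconv_pos_uniform (O D : set Rd) : open O -> O !=set0 -> bounded_set D ->
  exists2 c : R, 0 < c & forall x, D x -> (c%:E <= kconv O x)%E.
Proof.
move=> oO [y0 Oy0] bD.
(* The local bound is about bounded sets, hence the cut by a ball around 0
   that still contains y0. *)
pose O' := O `&` ball (0 : Rd) (`|y0| + 1).
have oO' : open O' by apply: openI => //; apply: ball_open.
have mO' := measurable_rV_open oO'.
have mO := measurable_rV_open oO.
have O'y0 : O' y0.
  by split => //; rewrite -ball_normE /= sub0r normrN ltrDl.
have O'pos x : (0 < kconv O' x)%E by apply: kconv_open_pos => //; exists y0.
have loc (x : Rd) : exists c : R, 0 < c /\ \forall x' \near x, (c%:E <= kconv O' x')%E.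
  by apply: (@kconv_locally_pos _ (`|y0| + 1)) => //; exact: subIsetr.
have [r [_ Dr]] := bD.
have {}Dr : D `<=` closed_ball (0 : Rd) (`|r| + 1).
  move=> x Dx; rewrite closed_ballE ?ltr_wpDl// /closed_ball_ /= sub0r normrN.
  by apply: Dr => //; rewrite (le_lt_trans (ler_norm _))// ltrDl.
have cK : compact (closed_ball (0 : Rd) (`|r| + 1)).
  apply: bounded_closed_compact; last exact: closed_ball_closed.
  exists (`|r| + 1); split; first by rewrite num_real.
  move=> s rs x; rewrite closed_ballE ?ltr_wpDl// /closed_ball_ /= sub0r normrN.
  by move=> /le_trans; apply; exact: ltW.
have : \forall c \near (0 : R)^'+, closed_ball (0 : Rd) (`|r| + 1) `<=`
    [set x | (c%:E <= kconv O' x)%E].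
  move/compact_near_coveringP : cK; apply.
  move=> x _; have [c [c0 xc]] := loc x.
  near=> x' e => /=; apply: (@le_trans _ _ c%:E); last by near: x'.
  by rewrite lee_fin; near: e; exact: nbhs_right_le.
move=> H; have [c [c0 Hc]] := @filter_ex _ _ (at_right_proper_filter (0 : R)) _
  (filterI (nbhs_right_gt (0 : R)) H).
exists c => // x /Dr /Hc /= /le_trans; apply.
apply: ge0_subset_integral => //.
- apply: measurable_funTS; apply/measurable_EFinP; exact: measurable_kernel_reflect.
- by move=> y _; rewrite lee_fin.
- exact: subIsetl.
Unshelve. all: by end_near. Qed.

End kernel_convolution.

(** * Coercivity: carrying L2 control along jumps *)

Section energy_estimates.
Context {R : realType} {d : nat}.
Local Notation Rd := 'rV[R]_d.
Local Notation mu := (@lebesgue_rV R d).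
Variables m nu0 : Rd -> R.
Hypotheses (mm : measurable_fun setT m) (m_ge0 : forall h, 0 <= m h)
  (m_le1 : forall h, m h <= 1) (m_sym : forall h, m (- h) = m h)
  (m_fin : (\int[mu]_h (m h)%:E < +oo)%E)
  (m_pos : forall U : set Rd, open U -> U !=set0 -> (0 < \int[mu]_(h in U) (m h)%:E)%E).
Hypotheses (mnu : measurable_fun setT nu0) (m_le_nu : forall h, m h <= nu0 h).
Variable Omega : set Rd.
Hypotheses (oOmega : open Omega).

Let nu_ge0 h : 0 <= nu0 h := le_trans (m_ge0 h) (m_le_nu h).
Let mOmega : measurable Omega := measurable_rV_open oOmega.

Definition jump_energy (u : Rd -> R) : \bar R :=
  (\int[mu]_(x in Omega) \int[mu]_y ((u x - u y) ^+ 2 * nu0 (x - y))%:E)%E.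

Let mjump (u : Rd -> R) : measurable_fun setT u ->
  measurable_fun setT (fun z : Rd * Rd => ((u z.1 - u z.2) ^+ 2 * nu0 (z.1 - z.2))%:E).
Proof.
move=> mfu; apply/measurable_EFinP/measurable_funM; last exact: measurable_kernel_sub.
apply: measurable_funX; apply: measurable_funB.
  exact: measurableT_comp mfu measurable_fst.
exact: measurableT_comp mfu measurable_snd.
Qed.

Let jump_in_ge0 (u : Rd -> R) x y : (0 <= ((u x - u y) ^+ 2 * nu0 (x - y))%:E)%E.
Proof. by rewrite lee_fin mulr_ge0// sqr_ge0. Qed.

Let msqr (u : Rd -> R) : measurable_fun setT u -> measurable_fun setT (fun x : Rd => (u x ^+ 2)%:E).
Proof. by move=> mfu; apply/measurable_EFinP; exact: measurable_funX. Qed.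

Let sqrE_ge0 (u : Rd -> R) x : (0 <= (u x ^+ 2)%:E)%E.
Proof. by rewrite lee_fin sqr_ge0. Qed.

Lemma jump_ge0 u : (0 <= jump_energy u)%E.
Proof. by apply: integral_ge0 => x _; apply: integral_ge0 => y _. Qed.

Let sqr_le2 (a b : R) : a ^+ 2 <= 2 * (a - b) ^+ 2 + 2 * b ^+ 2.
Proof. rewrite -subr_ge0; have := sqr_ge0 (a - 2 * b); nra. Qed.

(** Integrate u(x)^2 <= 2 (u(x) - u(y))^2 + 2 u(y)^2 against m(x - y), first in y
    over A, then in x over D; the factor m is at most nu0 in the first term and
    at most 1 in the second. *)
Lemma transfer_control (A D : set Rd) (c : R) (u : Rd -> R) :
  measurable A -> measurable D -> D `<=` Omega -> (mu D < +oo)%E -> 0 <= c ->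
  (forall x, D x -> (c%:E <= kconv m A x)%E) -> measurable_fun setT u ->
  (c%:E * \int[mu]_(x in D) (u x ^+ 2)%:E <=
   2%:E * jump_energy u + (2 * fine (mu D))%:E * \int[mu]_(y in A) (u y ^+ 2)%:E)%E.
Proof.
move=> mA mD DO Doo c0 cA mfu.
set I := (\int[mu]_(y in A) _)%E.
have I0 : (0 <= I)%E by apply: integral_ge0 => y _.
pose J x := (\int[mu]_y ((u x - u y) ^+ 2 * nu0 (x - y))%:E)%E.
have J0 x : (0 <= J x)%E by apply: integral_ge0 => y _.
have mJ : measurable_fun setT J.
  exact: (measurable_fun_integral_dom mu (mjump mfu)
    (fun z => jump_in_ge0 u z.1 z.2) measurableT).
have mcst (r : \bar R) : measurable_fun [set: Rd] (fun=> r) by exact: measurable_cst.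
have key x : D x -> (c%:E * (u x ^+ 2)%:E <= 2%:E * J x + 2%:E * I)%E.
  move=> Dx.
  apply: (@le_trans _ _ ((u x ^+ 2)%:E * kconv m A x)%E).
    by rewrite muleC lee_wpmul2l// cA.
  have mk : measurable_fun setT (fun y : Rd => (m (x - y))%:E).
    by apply/measurable_EFinP; exact: measurable_kernel_reflect.
  have mj : measurable_fun setT (fun y : Rd => ((u x - u y) ^+ 2 * nu0 (x - y))%:E).
    have := measurableT_comp (mjump mfu) (pair1_measurable x); exact.
  rewrite -ge0_integralZl_EFin//; last 3 first.
  - by move=> y _; rewrite lee_fin.
  - exact: measurable_funTS.
  - exact: sqr_ge0.
  apply: (@le_trans _ _ (\int[mu]_(y in A) (2%:E * ((u x - u y) ^+ 2 * nu0 (x - y))%:E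
       + 2%:E * (u y ^+ 2)%:E))%E).
    apply: ge0_le_integral => //.
    - by move=> y _; rewrite mule_ge0// lee_fin.
    - by apply: measurable_funTS; exact: emeasurable_funM.
    - by apply: measurable_funTS; apply: emeasurable_funD; apply: emeasurable_funM => //; exact: msqr.
    - move=> y _; rewrite -!EFinM -EFinD lee_fin.
      apply: (@le_trans _ _ ((2 * (u x - u y) ^+ 2 + 2 * u y ^+ 2) * m (x - y))).
        by rewrite ler_wpM2r// sqr_le2.
      rewrite mulrDl lerD//.
        by rewrite -mulrA !ler_wpM2l// sqr_ge0.
      by rewrite ler_piMr// mulr_ge0// sqr_ge0.
  rewrite ge0_integralD//; last 4 first.
  - by move=> y _; rewrite mule_ge0.
  - by apply: measurable_funTS; exact: emeasurable_funM.
  - by move=> y _; rewrite mule_ge0.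
  - by apply: measurable_funTS; apply: emeasurable_funM => //; exact: msqr.
  rewrite !ge0_integralZl_EFin//; last 2 first.
  - by apply: measurable_funTS; exact: msqr.
  - exact: measurable_funTS.
  rewrite leeD// lee_wpmul2l//.
  by apply: ge0_subset_integral.
rewrite -ge0_integralZl_EFin//; last by apply: measurable_funTS; exact: msqr.
apply: (@le_trans _ _ (\int[mu]_(x in D) (2%:E * J x + 2%:E * I))%E).
  apply: ge0_le_integral => //.
  - by move=> x _; rewrite mule_ge0// lee_fin.
  - by apply: measurable_funTS; apply: emeasurable_funM => //; exact: msqr.
  - by apply: measurable_funTS; apply: emeasurable_funD => //; exact: emeasurable_funM.
rewrite ge0_integralD//; last 3 first.
- by move=> x _; rewrite mule_ge0.
- by apply: measurable_funTS; exact: emeasurable_funM.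
- by move=> x _; rewrite mule_ge0.
rewrite ge0_integralZl_EFin//; last exact: measurable_funTS.
rewrite leeD//.
  by rewrite lee_wpmul2l//; apply: ge0_subset_integral => //; exact: measurable_funTS.
rewrite integral_cst// EFinM fineK ?ge0_fin_numE//.
by rewrite muleAC.
Qed.

(** The inequality of transfer_control with the roles exchanged: u is known on B
    and estimated everywhere, and the mass of m replaces the measure of D.  For
    m = min(1, nu) the weight kconv m B is nu_tilde on Omega^c. *)
Lemma weighted_trace (B : set Rd) (u : Rd -> R) :
  measurable B -> B `<=` Omega -> measurable_fun setT u ->
  (\int[mu]_x ((u x ^+ 2)%:E * kconv m B x) <=
   2%:E * jump_energy u +
   (2 * fine (\int[mu]_h (m h)%:E))%:E * \int[mu]_(x in Omega) (u x ^+ 2)%:E)%E.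
Proof.
move=> mB BO mfu.
set M := (\int[mu]_h (m h)%:E)%E.
have M0 : (0 <= M)%E by apply: integral_ge0 => h _; rewrite lee_fin.
have Mfin : M \is a fin_num by rewrite ge0_fin_numE.
pose F (z : Rd * Rd) := (u z.1 ^+ 2 * m (z.1 - z.2))%:E.
have F0 z : (0 <= F z)%E by rewrite lee_fin mulr_ge0// sqr_ge0.
have mF : measurable_fun setT F.
  apply/measurable_EFinP/measurable_funM; last exact: measurable_kernel_sub.
  by apply: measurable_funX; exact: measurableT_comp mfu measurable_fst.
have mmx (x : Rd) : measurable_fun setT (fun y : Rd => (m (x - y))%:E).
  by apply/measurable_EFinP; exact: measurable_kernel_reflect.
have -> : (\int[mu]_x ((u x ^+ 2)%:E * kconv m B x) =
  \int[mu]_x \int[mu]_(y in B) F (x, y))%E.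
  apply: eq_integral => x _; rewrite -ge0_integralZl_EFin//; last 3 first.
  - by move=> y _; rewrite lee_fin.
  - exact: measurable_funTS.
  - exact: sqr_ge0.
rewrite (tonelli_setX_swap mu mu mF F0 measurableT mB).
pose J x := (\int[mu]_y ((u x - u y) ^+ 2 * nu0 (x - y))%:E)%E.
have J0 x : (0 <= J x)%E by apply: integral_ge0 => y _.
have mJ : measurable_fun setT J.
  exact: (measurable_fun_integral_dom mu (mjump mfu)
    (fun z => jump_in_ge0 u z.1 z.2) measurableT).
apply: (@le_trans _ _ (\int[mu]_(y in B) (2%:E * J y + (2 * fine M)%:E * (u y ^+ 2)%:E))%E).
  apply: ge0_le_integral => //.
  - by move=> y _; apply: integral_ge0 => x _.
  - apply: measurable_funTS.
    have mG : measurable_fun setT (F \o (fun z : Rd * Rd => (z.2, z.1))).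
      by apply: measurableT_comp mF _; exact: measurable_swap.
    exact: (measurable_fun_integral_dom mu mG (fun z => F0 (z.2, z.1)) measurableT).
  - by apply: measurable_funTS; apply: emeasurable_funD; apply: emeasurable_funM => //; exact: msqr.
  move=> y By.
  have mj : measurable_fun setT (fun x : Rd => ((u y - u x) ^+ 2 * nu0 (y - x))%:E).
    have := measurableT_comp (mjump mfu) (pair1_measurable y); exact.
  have mFy : measurable_fun setT (fun x : Rd => F (x, y)).
    exact: measurableT_comp mF (pair2_measurable y).
  apply: (@le_trans _ _ (\int[mu]_x (2%:E * ((u y - u x) ^+ 2 * nu0 (y - x))%:E
       + (2 * u y ^+ 2)%:E * (m (y - x))%:E))%E).
    apply: ge0_le_integral => //.
    - by apply: emeasurable_funD; exact: emeasurable_funM.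
    - move=> x _; rewrite /F /= -!EFinM -EFinD lee_fin -(m_sym (x - y)) opprB.
      apply: (@le_trans _ _ ((2 * (u x - u y) ^+ 2 + 2 * u y ^+ 2) * m (y - x))).
        by rewrite ler_wpM2r// sqr_le2.
      rewrite mulrDl lerD// -(opprB (u y)) sqrrN.
      by rewrite -mulrA !ler_wpM2l// sqr_ge0.
  rewrite ge0_integralD//; last 4 first.
  - by move=> x _; rewrite mule_ge0.
  - exact: emeasurable_funM.
  - by move=> x _; rewrite mule_ge0// lee_fin// mulr_ge0// sqr_ge0.
  - exact: emeasurable_funM.
  rewrite !ge0_integralZl_EFin//; last 2 first.
  - by move=> x _; rewrite lee_fin.
  - by rewrite mulr_ge0// sqr_ge0.
  rewrite integral_kernel_reflect// -/M -{1}(fineK Mfin) -!EFinM leeD// lee_fin.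
  by rewrite mulrAC.
rewrite ge0_integralD//; last 4 first.
- by move=> x _; rewrite mule_ge0.
- by apply: measurable_funTS; exact: emeasurable_funM.
- by move=> x _; rewrite mule_ge0// lee_fin mulr_ge0// fine_ge0.
- by apply: measurable_funTS; apply: emeasurable_funM => //; exact: msqr.
rewrite !ge0_integralZl_EFin//; last 3 first.
- by apply: measurable_funTS; exact: msqr.
- by rewrite mulr_ge0// fine_ge0.
- exact: measurable_funTS.
rewrite leeD//.
  by rewrite lee_wpmul2l//; apply: ge0_subset_integral => //; exact: measurable_funTS.
rewrite lee_wpmul2l//; first by rewrite lee_fin mulr_ge0// fine_ge0.
by apply: ge0_subset_integral => //; apply: measurable_funTS; exact: msqr.
Qed.

Lemma bounded_lty (A : set Rd) : measurable A -> bounded_set A -> (mu A < +oo)%E.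
Proof.
move=> mA [r [_ Ar]]; apply: le_lt_trans (cube_lty (n := d) (`|r| + 1)).
apply: le_measure; rewrite ?inE//; first exact: measurable_cube.
move=> x Ax i /=; rewrite in_itv/= -ler_norml.
have := Ar (`|r| + 1) _ x Ax; rewrite (le_lt_trans (ler_norm _)) ?ltrDl// => /(_ isT).
apply: le_trans; rewrite [leRHS]/Num.Def.normr /= mx_normrE.
by apply/bigmax_geP; right => /=; exists (ord0, i).
Qed.

(** Control passes from a set A outside Omega where beta is bounded below, to a
    ball O inside Omega, and from there to the whole of Omega. *)
Lemma friedrichs (beta : Rd -> R) :
  bounded_set Omega -> Omega !=set0 ->
  measurable_fun (~` Omega) beta ->
  (forall y, (~` Omega) y -> 0 <= beta y) ->
  (0 < mu (~` Omega `&` [set y | (0 < beta y)%R]))%E ->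
  exists2 C : R, 0 < C & forall u : Rd -> R, measurable_fun setT u ->
    (\int[mu]_(x in Omega) (u x ^+ 2)%:E <=
     C%:E * (jump_energy u + \int[mu]_(y in ~` Omega) (u y ^+ 2 * beta y)%:E))%E.
Proof.
move=> bO O0 mbeta beta0 betapos.
have mOc : measurable (~` Omega) by exact: measurableC.
have Ooo := bounded_lty mOmega bO.
pose F (n : nat) := (~` Omega `&` beta @^-1` `[n.+1%:R^-1, +oo[) `&` ball (0 : Rd) n%:R.
have mball (x : Rd) r : measurable (ball x r) by apply: measurable_rV_open; exact: ball_open.
have mF n : measurable (F n).
  by apply: measurableI => //; exact: mbeta.
have FE : ~` Omega `&` [set y | 0 < beta y] = \bigcup_n F n.
  apply/seteqP; split=> [y [nOy /= by0]|y [n _ [[nOy /=]]]]; last first.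
    by rewrite in_itv/= andbT => bn _; split => //=; apply: lt_le_trans bn; rewrite invr_gt0.
  exists (maxn (Num.truncn (beta y)^-1) (Num.truncn `|y|).+1) => //; split; first split => //=.
    rewrite in_itv/= andbT invf_ple ?posrE// ltW// (lt_le_trans (truncnS_gt _))//.
    by rewrite ler_nat ltnS leq_maxl.
  rewrite -ball_normE /= sub0r normrN (lt_le_trans (truncnS_gt _))// ler_nat.
  exact: leq_maxr.
have [n Fn] : exists n, (0 < mu (F n))%E.
  apply/not_existsP => H; move: betapos; rewrite FE; apply/negP; rewrite -leNgt.
  apply: (le_trans (measure_sigma_subadditive _ mF _ _)) => //.
    exact: bigcup_measurable.
  rewrite eseries0// => i _ _; apply/eqP; rewrite eq_le measure_ge0 andbT leNgt.
  exact/negP/H.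
set A := F n in Fn; have mA : measurable A by exact: mF.
have Ar : A `<=` ball (0 : Rd) n%:R by exact: subIsetr.
(* Otherwise m * 1_A vanishes on Omega, so by Tonelli m * 1_Omega integrates to
   zero over A; but it is positive everywhere and A is not negligible. *)
have [x0 [Ox0 Ax0]] : exists x0, Omega x0 /\ (0 < kconv m A x0)%E.
  apply/not_existsP => H.
  have kA0 x : Omega x -> kconv m A x = 0%E.
    move=> Ox; apply/eqP; rewrite eq_le (kconv_ge0 m_ge0) andbT leNgt; apply/negP => kA.
    by apply: (H x).
  have mk : measurable_fun setT (fun z : Rd * Rd => (m (z.1 - z.2))%:E).
    by apply/measurable_EFinP; exact: measurable_kernel_sub.
  have k0 z : (0 <= (fun z : Rd * Rd => (m (z.1 - z.2))%:E) z)%E by rewrite lee_fin.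
  have : (\int[mu]_(y in A) kconv m Omega y = 0)%E.
    transitivity (\int[mu]_(x in Omega) kconv m A x)%E; last exact: integral0_eq.
    rewrite [RHS](tonelli_setX_swap mu mu mk k0 mOmega mA).
    apply: eq_integral => y _; apply: eq_integral => x _ /=.
    by rewrite -m_sym opprB.
  have kO y : (0 < kconv m Omega y)%E by exact: kconv_open_pos.
  have mkO : measurable_fun A (kconv m Omega).
    apply: measurable_funTS.
    exact: (measurable_fun_integral_dom mu mk k0 mOmega).
  rewrite -(eq_integral _ _ (fun y _ => gee0_abs (ltW (kO y)))).
  move=> /(ae_eq_integral_abs mu mA mkO)[N [mN N0 NA]].
  move: Fn; apply/negP; rewrite -leNgt -N0 le_measure ?inE// => y Ay.
  by apply: NA => /= /(_ Ay) ky; have := kO y; rewrite ky ltxx.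
have [c1 [c10 c1loc]] := kconv_locally_pos mm m_ge0 m_le1 m_fin mA Ar Ax0.
have [e /= e0 eB] : exists2 e : R, 0 < e & ball x0 e `<=`
    Omega `&` [set x | (c1%:E <= kconv m A x)%E].
  have /nbhs_ballP[e /= e0 eB] : nbhs x0 (Omega `&` [set x | (c1%:E <= kconv m A x)%E]).
    by apply: filterI => //; exact: open_nbhs_nbhs.
  by exists e.
set O := ball x0 e in eB.
have mO : measurable O by exact: mball.
have OO : O `<=` Omega by move=> x /eB[].
have Ofin : (mu O < +oo)%E by rewrite (le_lt_trans _ Ooo)// le_measure ?inE.
have [c2 c20 c2O] := kconv_pos_uniform mm m_ge0 m_le1 m_fin m_pos (ball_open x0 e)
  (ex_intro _ x0 (ballxx x0 e0)) bO.
pose aO := fine (mu O); pose aOm := fine (mu Omega).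
have aO0 : 0 <= aO by exact: fine_ge0.
have aOm0 : 0 <= aOm by exact: fine_ge0.
pose C1 := (2 + 2 * aO * n.+1%:R) / c1.
have C10 : 0 < C1 by rewrite divr_gt0// ltr_pwDl// !mulr_ge0.
pose C2 := (2 + 2 * aOm * C1) / c2.
have C20 : 0 < C2.
  by rewrite divr_gt0// ltr_pwDl//; apply: mulr_ge0; [exact: mulr_ge0|exact: ltW].
exists C2 => // u mfu.
set G := (jump_energy u + _)%E.
have Jb0 : (0 <= \int[mu]_(y in ~` Omega) (u y ^+ 2 * beta y)%:E)%E.
  by apply: integral_ge0 => y Oy; rewrite lee_fin mulr_ge0 ?sqr_ge0 ?beta0.
have JG : (jump_energy u <= G)%E by rewrite leeDl.
have G0 : (0 <= G)%E by rewrite adde_ge0// jump_ge0.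
(* One application of transfer_control, rewritten with G = jump energy plus
   boundary term as the only quantity on the right. *)
have chain (c a b : R) (X Y : \bar R) : 0 < c -> 0 <= a -> 0 <= b ->
    (c%:E * X <= 2%:E * jump_energy u + (2 * a)%:E * Y)%E -> (Y <= b%:E * G)%E ->
    (X <= ((2 + 2 * a * b) / c)%:E * G)%E.
  move=> c0 a0 b0 XY YG.
  rewrite mulrC EFinM -muleA lee_pdivlMl//; apply: le_trans XY _.
  have -> : (2 + 2 * a * b)%:E = (2%:E + (2 * a * b)%:E)%E by rewrite EFinD.
  rewrite ge0_muleDl ?lee_fin ?mulr_ge0//; apply: leeD; first by rewrite lee_wpmul2l.
  by rewrite [(2 * a * b)%:E]EFinM -muleA lee_wpmul2l// lee_fin mulr_ge0.
have stepA : (\int[mu]_(y in A) (u y ^+ 2)%:E <= n.+1%:R%:E * G)%E.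
  apply: (@le_trans _ _ (n.+1%:R%:E * \int[mu]_(y in ~` Omega) (u y ^+ 2 * beta y)%:E)%E).
    have mub : measurable_fun (~` Omega) (fun y => (u y ^+ 2 * beta y)%:E).
      apply/measurable_EFinP/measurable_funM => //.
      by apply: measurable_funTS; exact: measurable_funX.
    have AOc : A `<=` ~` Omega by move=> y [[]].
    have ub0 y : (~` Omega) y -> (0 <= (u y ^+ 2 * beta y)%:E)%E.
      by move=> Oy; rewrite lee_fin mulr_ge0 ?sqr_ge0 ?beta0.
    apply: (@le_trans _ _ (n.+1%:R%:E * \int[mu]_(y in A) (u y ^+ 2 * beta y)%:E)%E); last first.
      by rewrite lee_wpmul2l//; exact: ge0_subset_integral.
    rewrite -ge0_integralZl_EFin//; last 2 first.
    - by move=> y /AOc; exact: ub0.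
    - exact: measurable_funS mub.
    apply: ge0_le_integral => //.
    - by apply: measurable_funTS; exact: msqr.
    - by apply: emeasurable_funM => //; exact: measurable_funS mub.
    move=> y [[Oy /=]]; rewrite in_itv/= andbT => bn _.
    rewrite lee_fin mulrCA ler_peMr ?sqr_ge0//.
    by rewrite -ler_pdivrMl// mulr1.
  by rewrite lee_wpmul2l// leeDr// jump_ge0.
apply: (chain _ _ _ _ _ c20 aOm0 (ltW C10)
  (transfer_control mO mOmega (@subset_refl _ Omega) Ooo (ltW c20) c2O mfu)).
apply: (chain _ _ _ _ _ c10 aO0 (ler0n _ n.+1)
  (transfer_control mA mO OO Ofin (ltW c10) (fun x Ox => (eB x Ox).2) mfu)).
exact: stepA.
Qed.

End energy_estimates.

(** * Representation of functionals by minimisation *)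

Section semi_inner_product.
Context {R : realType} {T : Type}.
Variables (V : (T -> R) -> Prop) (a : (T -> R) -> (T -> R) -> R).
Let lin (t : R) (u v : T -> R) : T -> R := fun x => t * u x + v x.
Hypotheses (Vlin : forall t u v, V u -> V v -> V (lin t u v))
  (aC : forall u v, V u -> V v -> a u v = a v u)
  (aL : forall t u v w, V u -> V v -> V w -> a (lin t u v) w = t * a u w + a v w)
  (a_ge0 : forall u, V u -> 0 <= a u u).

Lemma discriminant_le (A B C : R) : 0 <= A ->
  (forall t, 0 <= t ^+ 2 * A + 2 * t * B + C) -> B ^+ 2 <= C * A.
Proof.
move=> A0 H; have [A00|A_neq0] := eqVneq A 0.
  rewrite A00 mulr0; have [->|B0] := eqVneq B 0; first by rewrite expr0n.
  have := H (- (C + 1) / (2 * B)); rewrite A00 mulr0 add0r.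
  have -> : 2 * (- (C + 1) / (2 * B)) * B = - (C + 1) by field.
  by move=> h; exfalso; lra.
have {A_neq0}A0 : 0 < A by rewrite lt_neqAle eq_sym A_neq0.
have := H (- B / A).
have -> : (- B / A) ^+ 2 * A + 2 * (- B / A) * B + C = (C * A - B ^+ 2) / A.
  by field; rewrite gt_eqF.
by rewrite pmulr_lge0 ?invr_gt0// subr_ge0.
Qed.

Lemma form_expand t u v : V u -> V v ->
  a (lin t v u) (lin t v u) = t ^+ 2 * a v v + 2 * t * a u v + a u u.
Proof.
move=> Vu Vv; have Vw := Vlin t Vv Vu.
rewrite aL// [a v _]aC// [a u _]aC// !aL// (aC Vv Vu); ring.
Qed.

Lemma form_cauchy_schwarz u v : V u -> V v -> a u v ^+ 2 <= a u u * a v v.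
Proof.
move=> Vu Vv; apply: discriminant_le; first exact: a_ge0.
by move=> t; rewrite -form_expand// a_ge0//; exact: Vlin.
Qed.

Variables (l : (T -> R) -> R) (K : R).
Hypotheses (V0 : exists u, V u)
  (lL : forall t u v, V u -> V v -> l (lin t u v) = t * l u + l v)
  (lK : forall v, V v -> l v ^+ 2 <= K * a v v) (K0 : 0 <= K)
  (complete : forall u_ : nat -> T -> R, (forall n, V (u_ n)) ->
    (forall e, 0 < e -> exists N, forall i k, (N <= i)%N -> (N <= k)%N ->
       a (lin (-1) (u_ k) (u_ i)) (lin (-1) (u_ k) (u_ i)) <= e) ->
    exists2 u, V u & forall e, 0 < e -> exists N, forall n, (N <= n)%N ->
       a (lin (-1) u (u_ n)) (lin (-1) u (u_ n)) <= e).

Let J u := a u u - 2 * l u.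

Let J_lbound u : V u -> - K <= J u.
Proof.
move=> Vu; have := lK Vu; have := a_ge0 Vu; rewrite /J.
move: (a u u) (l u) K K0 => A B k k0 A0 BkA.
rewrite leNgt; apply/negP => h.
have h1 : 0 <= k + A by exact: addr_ge0.
have h2 : k + A < 2 * B by lra.
have h3 : (k + A) ^+ 2 < (2 * B) ^+ 2 by rewrite ltrXn2r// ?nnegrE//; lra.
have := sqr_ge0 (k - A); nra.
Qed.

(** J (u + t v) >= J u - e for all t is a quadratic inequality in t; its
    discriminant says that u almost solves the variational equation. *)
Let near_minimiser (j e : R) u : (forall v, V v -> j <= J v) -> V u -> J u <= j + e ->
  forall v, V v -> (a u v - l v) ^+ 2 <= e * a v v.
Proof.
move=> jJ Vu Ju v Vv; apply: discriminant_le; first exact: a_ge0.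
move=> t; have := jJ _ (Vlin t Vv Vu).
rewrite /J form_expand// lL//; move: Ju; rewrite /J; lra.
Qed.

(** Both the Cauchy property of a minimising sequence and the equation for its
    limit come out of near_minimiser: test the first with the difference of two
    terms, the second with an arbitrary v.  The form may be degenerate;
    completeness is assumed for its seminorm, with functions taken pointwise. *)
Lemma riesz_representation : exists2 u, V u & forall v, V v -> a u v = l v.
Proof.
pose S := [set J u | u in V].
have S0 : S !=set0 by case: V0 => u Vu; exists (J u), u.
have lbS : has_lbound S by exists (- K) => _ [u Vu <-]; exact: J_lbound.
pose j := inf S.
have jJ v : V v -> j <= J v by move=> Vv; apply: ge_inf => //; exists v.
have /choice[u_ uP] : forall n : nat, exists u, V u /\ J u <= j + n.+1%:R^-1.
  move=> n; have [//|_ [u Vu <-] /ltW Ju] := @inf_adherent _ S n.+1%:R^-1 _ (conj S0 lbS).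
  by exists u.
have Vu_ n : V (u_ n) := (uP n).1.
have Ju_ n := near_minimiser jJ (Vu_ n) (uP n).2.
have cauchy e : 0 < e -> exists N, forall i k, (N <= i)%N -> (N <= k)%N ->
       a (lin (-1) (u_ k) (u_ i)) (lin (-1) (u_ k) (u_ i)) <= e.
  move=> e0; exists (Num.truncn (4 / e)) => i k Ni Nk.
  set w := lin _ _ _; have Vw : V w by exact: Vlin.
  have small n : (Num.truncn (4 / e) <= n)%N -> n.+1%:R^-1 <= e / 4.
    move=> Nn; rewrite -[e / 4]invrK invf_div lef_pV2 ?posrE// ?divr_gt0//.
    by rewrite (le_trans (ltW (truncnS_gt _)))// ler_nat ltnS.
  have aw : a w w = a (u_ i) w - a (u_ k) w by rewrite {1}/w aL// mulN1r addrC.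
  have := Ju_ i _ Vw; have := Ju_ k _ Vw.
  have := small _ Ni; have := small _ Nk; have := a_ge0 Vw.
  move: aw; move: (a w w) (a (u_ i) w) (a (u_ k) w) (l w) => A p q b -> A0 si sk h1 h2.
  rewrite leNgt; apply/negP => eA.
  have {}h1 : (q - b) ^+ 2 <= e / 4 * (p - q) by rewrite (le_trans h1)// ler_wpM2r.
  have {}h2 : (p - b) ^+ 2 <= e / 4 * (p - q) by rewrite (le_trans h2)// ler_wpM2r.
  have := sqr_ge0 ((p - b) + (q - b)); nra.
have [u Vu ulim] := complete Vu_ cauchy; exists u => // v Vv.
apply/eqP; rewrite -subr_eq0 -sqrf_eq0 eq_le sqr_ge0 andbT.
apply/ler_addgt0Pr => e e0; rewrite add0r.
pose c := 4 * (a v v + 1).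
have c0 : 0 < c by rewrite mulr_gt0// ltr_wpDl// a_ge0.
have [N HN] := ulim _ (divr_gt0 e0 c0).
pose n := maxn N (Num.truncn (c / e)).
have := HN n (leq_maxl _ _); have := Ju_ n v Vv.
set w := lin _ _ _ => h1 h2.
have Vw : V w by exact: Vlin.
have ne : n.+1%:R^-1 <= e / c.
  rewrite -[e / c]invrK invf_div lef_pV2 ?posrE// ?divr_gt0//.
  by rewrite (le_trans (ltW (truncnS_gt _)))// ler_nat ltnS leq_maxr.
have {}h1 : (a (u_ n) v - l v) ^+ 2 <= e / c * a v v.
  by rewrite (le_trans h1)// ler_wpM2r// a_ge0.
have h3 : a w v ^+ 2 <= e / c * a v v.
  by rewrite (le_trans (form_cauchy_schwarz Vw Vv))// ler_wpM2r// a_ge0.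
have awE : a w v = a (u_ n) v - a u v by rewrite aL// mulN1r addrC.
have h4 : 4 * (e / c * a v v) <= e.
  have -> : 4 * (e / c * a v v) = e * (4 * a v v / c) by ring.
  rewrite ler_piMr ?(ltW e0)// ler_pdivrMr// mul1r /c.
  have := a_ge0 Vv; lra.
rewrite awE in h3; have := sqr_ge0 ((a (u_ n) v - l v) + (a (u_ n) v - a u v)).
move: h1 h3 h4; nra.
Qed.

End semi_inner_product.

(** * Square-integrable functions *)

Section square_integrable.
Context d (T : measurableType d) (R : realType) (m : {measure set T -> \bar R}).
Implicit Types F G H : T -> R.

Definition sqint F : \bar R := (\int[m]_x (F x ^+ 2)%:E)%E.
Definition isL2 F := measurable_fun setT F /\ (sqint F < +oo)%E.
Definition dot F G : R := \int[m]_x (F x * G x).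

Lemma sqint_ge0 F : (0 <= sqint F)%E.
Proof. by apply: integral_ge0 => x _; rewrite lee_fin sqr_ge0. Qed.

Lemma measurable_sqr F : measurable_fun setT F -> measurable_fun setT (fun x => (F x ^+ 2)%:E).
Proof. by move=> mF; apply/measurable_EFinP; exact: measurable_funX. Qed.

Lemma sqint_lin (t : R) F G : measurable_fun setT F -> measurable_fun setT G ->
  (sqint (fun x => t * F x + G x)%R <= (2 * t ^+ 2)%:E * sqint F + 2%:E * sqint G)%E.
Proof.
move=> mF mG; have mF2 := measurable_sqr mF; have mG2 := measurable_sqr mG.
rewrite /sqint -ge0_integralZl_EFin//; last 2 first.
- by move=> x _; rewrite lee_fin sqr_ge0.
- by rewrite mulr_ge0// sqr_ge0.
rewrite -ge0_integralZl_EFin//; last by move=> x _; rewrite lee_fin sqr_ge0.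
rewrite -ge0_integralD//; last 4 first.
- by move=> x _; apply: mule_ge0; rewrite lee_fin; [apply: mulr_ge0 => //|]; exact: sqr_ge0.
- exact: emeasurable_funM.
- by move=> x _; apply: mule_ge0; rewrite lee_fin ?sqr_ge0.
- exact: emeasurable_funM.
apply: ge0_le_integral => //.
- by move=> x _; rewrite lee_fin sqr_ge0.
- by apply: measurable_sqr; apply: measurable_funD => //; exact: measurable_funM.
- by apply: emeasurable_funD; exact: emeasurable_funM.
move=> x _; rewrite -!EFinM -EFinD lee_fin.
have := sqr_ge0 (t * F x - G x); nra.
Qed.

Lemma isL2_lin (t : R) F G : isL2 F -> isL2 G -> isL2 (fun x => t * F x + G x).
Proof.
move=> [mF F2] [mG G2]; split.
  by apply: measurable_funD => //; exact: measurable_funM.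
apply: (le_lt_trans (sqint_lin t mF mG)).
apply: lte_add_pinfty; apply: lte_mul_pinfty => //.
by rewrite lee_fin; apply: mulr_ge0 => //; exact: sqr_ge0.
Qed.

Lemma isL2_integrable F G : isL2 F -> isL2 G -> m.-integrable setT (EFin \o (fun x => F x * G x)).
Proof.
move=> [mF F2] [mG G2]; apply/integrableP; split.
  by apply/measurable_EFinP; exact: measurable_funM.
apply: (@le_lt_trans _ _ (\int[m]_x ((F x ^+ 2)%:E + (G x ^+ 2)%:E))%E).
  apply: ge0_le_integral => //.
  - by apply/measurable_EFinP/measurableT_comp => //; exact: measurable_funM.
  - by apply: emeasurable_funD; exact: measurable_sqr.
  move=> x _ /=; rewrite lee_fin normrM -[F x ^+ 2]real_normK ?num_real//.
  rewrite -[G x ^+ 2]real_normK ?num_real//.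
  have := sqr_ge0 (`|F x| - `|G x|); have := sqr_ge0 (`|F x| + `|G x|); nra.
rewrite ge0_integralD//; first exact: lte_add_pinfty.
- by move=> x _; rewrite lee_fin sqr_ge0.
- exact: measurable_sqr.
- by move=> x _; rewrite lee_fin sqr_ge0.
- exact: measurable_sqr.
Qed.

Lemma dotC F G : dot F G = dot G F.
Proof. by apply: eq_Rintegral => x _; rewrite mulrC. Qed.

Lemma dotL t F G H : isL2 F -> isL2 G -> isL2 H ->
  dot (fun x => t * F x + G x) H = t * dot F H + dot G H.
Proof.
move=> LF LG LH; rewrite /dot; under eq_Rintegral do rewrite mulrDl -mulrA.
rewrite RintegralD//; last 2 first.
- have := isL2_integrable LF LH => /(integrableZl measurableT t).
  by apply: eq_integrable => // x _; rewrite /= EFinM.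
- exact: isL2_integrable.
by rewrite RintegralZl//; exact: isL2_integrable.
Qed.

Lemma dotR t F G H : isL2 F -> isL2 G -> isL2 H ->
  dot H (fun x => t * F x + G x) = t * dot H F + dot H G.
Proof. by move=> LF LG LH; rewrite dotC dotL// dotC (dotC G). Qed.

Lemma dot_sqint F : isL2 F -> (dot F F)%:E = sqint F.
Proof.
move=> LF; rewrite /dot /Rintegral fineK.
  by apply: eq_integral => x _; rewrite expr2.
by apply: integrable_fin_num => //; exact: (isL2_integrable LF LF).
Qed.

Lemma dot_ge0 F : 0 <= dot F F.
Proof. by apply: Rintegral_ge0 => x _; rewrite -expr2 sqr_ge0. Qed.

Lemma dot_cauchy_schwarz F G : isL2 F -> isL2 G -> dot F G ^+ 2 <= dot F F * dot G G.
Proof.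
apply: (@form_cauchy_schwarz _ _ isL2 dot).
- exact: isL2_lin.
- by move=> *; exact: dotC.
- exact: dotL.
- by move=> *; exact: dot_ge0.
Qed.

Lemma sqint_fatou (G_ : nat -> T -> R) H (e : R) (N : nat) :
  (forall k, measurable_fun setT (G_ k)) -> measurable_fun setT H ->
  {ae m, forall x, G_ k x @[k --> \oo] --> H x} ->
  (forall k, (N <= k)%N -> (sqint (G_ k) <= e%:E)%E) ->
  (sqint H <= e%:E)%E.
Proof.
move=> mG mH GH Ge.
case: GH => Z [mZ Z0 ZH].
have mZc : measurable (~` Z) by exact: measurableC.
pose g k x : \bar R := (G_ (k + N)%N x ^+ 2)%:E.
have mg k : measurable_fun setT (g k) by exact: measurable_sqr.
have mH2 := measurable_sqr mH.
have -> : sqint H = (\int[m]_(x in ~` Z) (H x ^+ 2)%:E)%E.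
  rewrite /sqint (ge0_negligible_integral mZ)//; last by move=> x _; rewrite lee_fin sqr_ge0.
  by rewrite setTD.
have -> : (\int[m]_(x in ~` Z) (H x ^+ 2)%:E = \int[m]_(x in ~` Z) limn_einf (g^~ x))%E.
  apply: eq_integral => x; rewrite inE => nZx; apply/esym.
  have GHx : G_ k x @[k --> \oo] --> H x.
    by apply: contrapT => nG; exact/nZx/ZH.
  suff /cvg_limn_einf_sup[] : g k x @[k --> \oo] --> (H x ^+ 2)%:E by [].
  apply: cvg_EFin; first exact: nearW.
  have GNx : G_ (k + N)%N x @[k --> \oo] --> H x by rewrite (cvg_shiftn N (G_^~ x)).
  exact: (cvgM GNx GNx).
apply: (le_trans (fatou m mZc (fun k => measurable_funTS (mg k)) _)).
  by move=> k x _; rewrite lee_fin sqr_ge0.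
rewrite limn_einf_lim; apply: lime_le; first exact: is_cvg_einfs.
apply: nearW => k; apply: le_trans (Ge (k + N)%N (leq_addl _ _)).
apply: (@le_trans _ _ (\int[m]_(x in ~` Z) g k x)%E).
  by apply: ereal_inf_lbound; exists k => /=.
by apply: ge0_subset_integral => // x _; rewrite lee_fin sqr_ge0.
Qed.

(** Along a subsequence whose increments have squared norm at most
    2^(-k-1) 4^(-k), the sum of 4^k times the squared increments is integrable,
    hence finite almost everywhere; there the increments are O(2^(-k)). *)
Lemma weighted_cauchy_subseq (w : T -> R) (u_ : nat -> T -> R) :
  measurable_fun setT w -> (forall x, 0 < w x) ->
  (forall n, measurable_fun setT (u_ n)) ->
  (forall e : R, 0 < e -> exists N, forall i k, (N <= i)%N -> (N <= k)%N ->
    (\int[m]_x ((u_ i x - u_ k x) ^+ 2 * w x)%:E <= e%:E)%E) ->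
  exists phi : nat -> nat, exists2 u : T -> R, measurable_fun setT u &
    (forall k, (k <= phi k)%N) /\
    {ae m, forall x, u_ (phi k) x @[k --> \oo] --> u x}.
Proof.
move=> mw w0 mfu uC.
pose e k : R := 1 / (2 ^ k.+1)%:R / 4 ^+ k.
have e0 k : 0 < e k by rewrite !divr_gt0// ?exprn_gt0// ltr0n expn_gt0.
have /choice[N HN] := fun k => uC _ (e0 k).
(* Summing the thresholds N i makes phi monotone and above each of them. *)
pose phi k := (k + \sum_(i < k.+1) N i)%N.
have phi_N k : (N k <= phi k)%N.
  by rewrite /phi big_ord_recr /= addnA leq_addl.
have phiS k : (phi k <= phi k.+1)%N.
  by rewrite /phi leq_add// [leqRHS]big_ord_recr leq_addr.
pose dl k x := u_ (phi k.+1) x - u_ (phi k) x.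
pose g k x : \bar R := (4 ^+ k * (dl k x ^+ 2 * w x))%:E.
have mdl k : measurable_fun setT (dl k) by exact: measurable_funB.
have mg k : measurable_fun setT (g k).
  apply/measurable_EFinP; apply: measurable_funM => //.
  by apply: measurable_funM => //; exact: measurable_funX.
have g0 k x : (0 <= g k x)%E.
  rewrite lee_fin mulr_ge0 ?exprn_ge0//; apply: mulr_ge0; first exact: sqr_ge0.
  exact: ltW.
pose S x := (\sum_(0 <= k <oo) g k x)%E.
have S0 x : (0 <= S x)%E by exact: nneseries_ge0.
have mS : measurable_fun setT S by apply: (@ge0_emeasurable_sum _ _ _ _ g xpredT).
have intS : m.-integrable setT S.
  apply/integrableP; split => //.
  under eq_integral do rewrite gee0_abs//.
  rewrite integral_nneseries//; apply: le_lt_trans (ltry 1).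
  apply: (le_trans _ (epsilon_trick0 xpredT (@ler01 R))).
  apply: lee_nneseries => [k _ _|k _]; first exact: integral_ge0.
  have mdw : measurable_fun setT (fun x => (dl k x ^+ 2 * w x)%:E).
    by apply/measurable_EFinP/measurable_funM => //; exact: measurable_funX.
  have dw0 x : (0 <= (dl k x ^+ 2 * w x)%:E)%E.
    by rewrite lee_fin; apply: mulr_ge0; [exact: sqr_ge0|exact: ltW].
  have -> : (\int[m]_x g k x = (4 ^+ k)%:E * \int[m]_x (dl k x ^+ 2 * w x)%:E)%E.
    by rewrite -ge0_integralZl_EFin. 
  apply: (@le_trans _ _ ((4 ^+ k)%:E * (e k)%:E)%E).
    rewrite lee_wpmul2l ?lee_fin ?exprn_ge0// HN//; exact: leq_trans (phiS k).
  by rewrite -EFinM lee_fin /e mulrC divfK// expf_neq0// pnatr_eq0.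
have [Z [mZ Z0 ZS]] := integrable_ae measurableT intS.
have mD : measurable (~` Z) by exact: measurableC.
have cvgu x : ~ Z x -> cvgn (fun k => u_ (phi k) x).
  move=> nZx; have Sfin : S x \is a fin_num.
    by apply: contrapT => nS; apply/nZx/ZS => /(_ I).
  set s := fine (S x).
  have gs k : 4 ^+ k * (dl k x ^+ 2 * w x) <= s.
    rewrite -lee_fin fineK//.
    apply: le_trans (nneseries_lim_ge k.+1 (fun n _ _ => g0 n x)).
    by rewrite big_nat_recr//= leeDr//; apply: sume_ge0.
  pose c := s / w x + 1.
  have s0 : 0 <= s by exact: fine_ge0.
  have c1 : 1 <= c by rewrite lerDr divr_ge0// ltW.
  have dlc k : `|dl k x| <= geometric c 2^-1 k.
    rewrite /geometric /= exprVn ler_pdivlMr ?exprn_gt0// mulrC.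
    rewrite -(@ler_pXn2r _ 2)// ?nnegrE ?mulr_ge0 ?exprn_ge0//; last by lra.
    rewrite exprMn real_normK ?num_real// -exprM mulnC exprM (_ : 2 ^+ 2 = 4 :> R); last by ring.
    apply: (@le_trans _ _ (s / w x)); first by rewrite ler_pdivlMr// -mulrA.
    apply: (@le_trans _ _ c); first by rewrite lerDl.
    by rewrite expr2 ler_peMl//; lra.
  have cvgdl : cvgn (series (dl^~ x)).
    apply: normed_cvg; apply: series_le_cvg dlc _ => //.
      by move=> n; rewrite /geometric /= mulr_ge0// ?exprn_ge0//; lra.
    by apply: is_cvg_geometric_series; rewrite ger0_norm//; lra.
  rewrite (_ : (fun k => _) = (fun k => u_ (phi 0%N) x + series (dl^~ x) k)).
    by apply: is_cvgD; [exact: is_cvg_cst|exact: cvgdl].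
  by apply/funext => k; rewrite -(eq_sum_telescope (fun k => u_ (phi k) x)).
(* Cutting with the complement of the exceptional set makes the convergence hold
   everywhere, which gives the measurability of the limit. *)
pose v k x := u_ (phi k) x * \1_(~` Z) x.
have mv k : measurable_fun setT (v k).
  by apply: measurable_funM => //; exact: measurable_indic.
pose u x := lim (v k x @[k --> \oo]).
have vu x : v k x @[k --> \oo] --> u x.
  rewrite /u /v indicE; have [/set_mem nZx|_] := boolP (x \in ~` Z).
    by under eq_fun do rewrite mulr1; exact: cvgu.
  by under eq_fun do rewrite mulr0; exact: is_cvg_cst.
exists phi, u; first by apply: measurable_fun_cvg mv _ => x _; exact: vu.
split; first by move=> k; exact: leq_addr.
exists Z; split => // x /= nx; apply: contrapT => nZx; apply: nx.
have := vu x; rewrite /v indicE mem_set//; under eq_fun do rewrite mulr1.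
exact.
Qed.

End square_integrable.

(** * The truncated Levy density *)

Section levy_kernel.
Context {R : realType} {d : nat}.
Local Notation Rd := 'rV[R]_d.
Local Notation mu := (@lebesgue_rV R d).
Variable nu : Rd -> R.
Hypotheses (nu_levy : levy_density nu) (nu_full : full_support nu).

(** A Levy density is unconstrained at the origin; the value 0 there keeps the
    extension measurable, even and nonnegative, and does not change jump energies
    because the squared difference vanishes on the diagonal. *)
Definition levy0 : Rd -> R := nu \_ (~` [set 0]).
Definition levy_trunc (h : Rd) : R := Num.min 1 (levy0 h).

Lemma measurable_rV_set1C : measurable (~` [set (0 : Rd)]).
Proof.
apply: measurable_rV_open; rewrite openC.
exact: (accessible_closed_set1 (hausdorff_accessible (@norm_hausdorff _ _))).
Qed.

Lemma levy0E (h : Rd) : h != 0 -> levy0 h = nu h.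
Proof. by move=> /eqP h0; rewrite /levy0 /patch mem_set. Qed.

Lemma levy00 : levy0 0 = 0.
Proof. by rewrite /levy0 /patch memNset//= => /(_ erefl). Qed.

Lemma measurable_levy0 : measurable_fun setT levy0.
Proof.
case: nu_levy => mnu _ _ _.
by apply/(measurable_restrictT _ _).1 => //; exact: measurable_rV_set1C.
Qed.

Lemma levy0_ge0 h : 0 <= levy0 h.
Proof.
case: nu_levy => _ nu0 _ _; have [->|h0] := eqVneq h 0; first by rewrite levy00.
by rewrite levy0E// nu0.
Qed.

Lemma levy0_sym h : levy0 (- h) = levy0 h.
Proof.
case: nu_levy => _ _ nuN _; have [->|h0] := eqVneq h 0; first by rewrite oppr0.
by rewrite !levy0E ?oppr_eq0// nuN.
Qed.

Lemma measurable_levy_trunc : measurable_fun setT levy_trunc.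
Proof. by apply: measurable_minr => //; exact: measurable_levy0. Qed.

Lemma levy_trunc_ge0 h : 0 <= levy_trunc h.
Proof. by rewrite /levy_trunc le_min ler01 levy0_ge0. Qed.

Lemma levy_trunc_le1 h : levy_trunc h <= 1.
Proof. by rewrite /levy_trunc ge_min lexx. Qed.

Lemma levy_trunc_le h : levy_trunc h <= levy0 h.
Proof. by rewrite /levy_trunc ge_min lexx orbT. Qed.

Lemma levy_trunc_sym h : levy_trunc (- h) = levy_trunc h.
Proof. by rewrite /levy_trunc levy0_sym. Qed.

Let enorm2 (h : Rd) : enorm h ^+ 2 = \sum_(i < d) h ord0 i ^+ 2.
Proof. by rewrite /enorm sqr_sqrtr// sumr_ge0// => i _; exact: sqr_ge0. Qed.

(** min(1, nu) is at most min(1, |h|^2) nu when |h| >= 1, and at most 1 on the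
    unit ball, which lies in a cube. *)
Lemma levy_trunc_fin : (\int[mu]_h (levy_trunc h)%:E < +oo)%E.
Proof.
case: nu_levy => mnu nu0 _ fin.
pose g (h : Rd) := Num.min 1 (enorm h ^+ 2) * levy0 h.
have g0 h : 0 <= g h.
  by apply: mulr_ge0; [rewrite le_min ler01 sqr_ge0|exact: levy0_ge0].
have mg : measurable_fun setT g.
  apply: measurable_funM; last exact: measurable_levy0.
  apply: measurable_minr => //; under eq_fun do rewrite enorm2.
  apply: measurable_sum => i; apply: measurable_funX; exact: measurable_rV_coord.
have gfin : (\int[mu]_h (g h)%:E < +oo)%E.
  apply: le_lt_trans fin; rewrite [leRHS]integral_mkcond le_eqVlt; apply/orP; left.
  apply/eqP; apply: eq_integral => h _; rewrite /g /levy0 /patch.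
  by case: ifP => //; rewrite mulr0.
have mC := measurable_cube (R := R) (n := d) 1.
apply: (@le_lt_trans _ _ (\int[mu]_h ((g h)%:E + (\1_(cube 1) h)%:E))%E).
  apply: ge0_le_integral => //.
  - by move=> h _; rewrite lee_fin levy_trunc_ge0.
  - apply/measurable_EFinP; exact: measurable_levy_trunc.
  - apply: emeasurable_funD; apply/measurable_EFinP => //; exact: measurable_indic.
  move=> h _; rewrite -EFinD lee_fin.
  have [h1|h1] := leP 1 (enorm h ^+ 2).
    apply: (le_trans (levy_trunc_le h)).
    by rewrite /g min_l// mul1r lerDl indicE ler0n.
  apply: (le_trans (levy_trunc_le1 h)).
  rewrite indicE mem_set ?lerDr//= => i /=.
  rewrite in_itv/= -ler_norml -(@ler_pXn2r _ 2)// ?nnegrE// expr1n real_normK ?num_real//.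
  apply: le_trans (ltW h1); rewrite enorm2 (bigD1 i)//= lerDl sumr_ge0// => j _.
  exact: sqr_ge0.
rewrite ge0_integralD//; last 3 first.
- by move=> h _; rewrite lee_fin.
- exact/measurable_EFinP.
- by apply/measurable_EFinP; exact: measurable_indic.
by apply: lte_add_pinfty => //; rewrite integral_indic// setIT cube_lty.
Qed.

(** If min(1, nu) integrates to zero over U then nu vanishes almost everywhere on
    U, which contradicts full support. *)
Lemma levy_trunc_pos (U : set Rd) : open U -> U !=set0 ->
  (0 < \int[mu]_(h in U) (levy_trunc h)%:E)%E.
Proof.
move=> oU [x Ux]; have mU := measurable_rV_open oU.
have : levy_support nu x by rewrite nu_full.
move=> /(_ U oU Ux) pos; rewrite lt_neqAle integral_ge0 ?andbT; last first.
  by move=> h _; rewrite lee_fin levy_trunc_ge0.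
apply/eqP => /esym I0; move: pos.
have mt : measurable_fun U (EFin \o levy_trunc).
  by apply: measurable_funTS; apply/measurable_EFinP; exact: measurable_levy_trunc.
have : (\int[mu]_(h in U) `|(EFin \o levy_trunc) h| = 0)%E.
  rewrite -[RHS]I0; apply: eq_integral => h _ /=.
  by rewrite ger0_norm// levy_trunc_ge0.
move=> /(ae_eq_integral_abs mu mU mt) t0.
have l0 : ae_eq mu U (EFin \o levy0) (cst 0%E).
  case: t0 => N [mN N0 NA]; exists N; split => // h /= nh.
  apply: NA => /= t0; apply: nh => /t0 [].
  by rewrite /levy_trunc minEle; case: ifP => _; [move/eqP; rewrite oner_eq0|move=> ->].
rewrite (_ : (\int[mu]_(h in U `\ 0%R) (nu h)%:E)%E = (\int[mu]_(h in U) (levy0 h)%:E)%E).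
  rewrite (ge0_ae_eq_integral mU _ _ _ _ l0)//.
  - by rewrite integral0 ltxx.
  - by apply: measurable_funTS; apply/measurable_EFinP; exact: measurable_levy0.
  - by move=> h _; rewrite lee_fin levy0_ge0.
rewrite integral_mkcond [RHS]integral_mkcond; apply: eq_integral => h _.
rewrite /patch /levy0 /patch in_setD; case: (h \in U) => //=.
by rewrite in_setC; case: ifP.
Qed.

End levy_kernel.

(** * The form domain and its completeness *)

Section robin_form.
Context {R : realType} {d : nat}.
Local Notation Rd := 'rV[R]_d.
Local Notation mu := (@lebesgue_rV R d).
Local Notation mu2 := (mu \x mu)%E.
Variables (k0 : Rd * Rd -> R) (beta0 : Rd -> R).
Hypotheses (mk0 : measurable_fun setT k0) (mbeta0 : measurable_fun setT beta0).

(** The square roots of the kernels are put into the functions, so that the form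
    becomes a sum of two plain L2 inner products. *)
Definition jump_part (u : Rd -> R) (z : Rd * Rd) : R := Num.sqrt (k0 z) * (u z.1 - u z.2).
Definition robin_part (u : Rd -> R) (y : Rd) : R := Num.sqrt (beta0 y) * u y.

Definition form_domain (u : Rd -> R) : Prop :=
  [/\ measurable_fun setT u, isL2 mu2 (jump_part u) & isL2 mu (robin_part u)].

Definition robin_form (u v : Rd -> R) : R :=
  2^-1 * dot mu2 (jump_part u) (jump_part v) + dot mu (robin_part u) (robin_part v).

Let lin (t : R) (u v : Rd -> R) : Rd -> R := fun x => t * u x + v x.

Let jump_lin t u v : jump_part (lin t u v) = fun z => t * jump_part u z + jump_part v z.
Proof. by apply/funext => z; rewrite /jump_part /lin; ring. Qed.

Let robin_lin t u v : robin_part (lin t u v) = fun z => t * robin_part u z + robin_part v z.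
Proof. by apply/funext => z; rewrite /robin_part /lin; ring. Qed.

Let measurable_lin t (u v : Rd -> R) : measurable_fun setT u -> measurable_fun setT v ->
  measurable_fun setT (lin t u v).
Proof. by move=> mfu mv; apply: measurable_funD => //; exact: measurable_funM. Qed.

Lemma form_domain_lin t u v : form_domain u -> form_domain v ->
  form_domain (fun x => t * u x + v x).
Proof.
move=> [mfu ju ru] [mv jv rv]; split; first exact: measurable_lin.
  by rewrite (jump_lin t u v); exact: isL2_lin.
by rewrite (robin_lin t u v); exact: isL2_lin.
Qed.

Lemma robin_formC u v : robin_form u v = robin_form v u.
Proof. by rewrite /robin_form dotC [dot mu _ _]dotC. Qed.

Lemma robin_formL t u v w : form_domain u -> form_domain v -> form_domain w ->
  robin_form (fun x => t * u x + v x) w = t * robin_form u w + robin_form v w.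
Proof.
move=> [_ ju ru] [_ jv rv] [_ jw rw].
rewrite /robin_form (jump_lin t u v) (robin_lin t u v) !dotL//; ring.
Qed.

Lemma robin_form_ge0 u : 0 <= robin_form u u.
Proof. by rewrite addr_ge0 ?mulr_ge0 ?dot_ge0. Qed.

Lemma robin_formE u : form_domain u ->
  (robin_form u u)%:E = (2^-1%:E * sqint mu2 (jump_part u) + sqint mu (robin_part u))%E.
Proof. by move=> [_ ju ru]; rewrite EFinD EFinM !dot_sqint. Qed.

Let measurable_sqrt : measurable_fun setT (@Num.sqrt R).
Proof. by apply: continuous_measurable_fun; exact: sqrt_continuous. Qed.

Lemma measurable_jump_part u : measurable_fun setT u -> measurable_fun setT (jump_part u).
Proof.
move=> mfu; apply: measurable_funM.
  by apply: measurableT_comp => //; exact: measurable_sqrt.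
apply: measurable_funB.
  exact: measurableT_comp mfu measurable_fst.
exact: measurableT_comp mfu measurable_snd.
Qed.

Lemma measurable_robin_part u : measurable_fun setT u -> measurable_fun setT (robin_part u).
Proof.
by move=> mfu; apply: measurable_funM => //; apply: measurableT_comp => //; exact: measurable_sqrt.
Qed.

Lemma negligible_fst_snd (Z : set Rd) : measurable Z -> mu Z = 0%E ->
  measurable (Z `*` setT `|` setT `*` Z) /\ mu2 (Z `*` setT `|` setT `*` Z) = 0%E.
Proof.
move=> mZ Z0.
have m1 : measurable (Z `*` [set: Rd]) by exact: measurableX.
have m2 : measurable ([set: Rd] `*` Z) by exact: measurableX.
have mU : measurable (Z `*` setT `|` setT `*` Z) by exact: measurableU.
split => //; apply/eqP; rewrite eq_le measure_ge0 andbT.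
apply: (le_trans (measureU2 _ m1 m2)).
have E1 : mu2 (Z `*` [set: Rd]) = 0%E.
  by apply: etrans (product_measure1E mu mu mZ measurableT) _; apply: etrans (congr1 (fun t => t * _)%E Z0) (mul0e _).
have E2 : mu2 ([set: Rd] `*` Z) = 0%E.
  by apply: etrans (product_measure1E mu mu measurableT mZ) _; apply: etrans (congr1 (fun t => _ * t)%E Z0) (mule0 _).
by rewrite [X in (X + _)%E]E1 [X in (_ + X)%E]E2 adde0.
Qed.

(** Fatou's lemma bounds u_n - u by the differences u_n - u_(phi k), in both parts
    of the form; an almost everywhere limit on R^d is one on R^d x R^d because
    Z x R^d and R^d x Z are negligible when Z is. *)
Lemma form_domain_complete (w : Rd -> R) (C : R) :
  measurable_fun setT w -> (forall x, 0 < w x) -> 0 < C ->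
  (forall u, form_domain u ->
     (\int[mu]_x (u x ^+ 2 * w x)%:E <= (C * robin_form u u)%:E)%E) ->
  forall u_ : nat -> Rd -> R, (forall n, form_domain (u_ n)) ->
    (forall e, 0 < e -> exists N, forall i k, (N <= i)%N -> (N <= k)%N ->
       robin_form (lin (-1) (u_ k) (u_ i)) (lin (-1) (u_ k) (u_ i)) <= e) ->
    exists2 u, form_domain u & forall e, 0 < e -> exists N, forall n, (N <= n)%N ->
       robin_form (lin (-1) u (u_ n)) (lin (-1) u (u_ n)) <= e.
Proof.
move=> mw w0 C0 coer u_ Vu uC.
have mfu n : measurable_fun setT (u_ n) by case: (Vu n).
have wC e : 0 < e -> exists N, forall i k, (N <= i)%N -> (N <= k)%N ->
    (\int[mu]_x ((u_ i x - u_ k x) ^+ 2 * w x)%:E <= e%:E)%E.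
  move=> e0; have [N HN] := uC _ (divr_gt0 e0 C0); exists N => i k Ni Nk.
  have := coer _ (form_domain_lin (-1) (Vu k) (Vu i)).
  under eq_integral do rewrite mulN1r addrC.
  by move=> /le_trans; apply; rewrite lee_fin -ler_pdivlMl// mulrC HN.
have [phi [u mu0 [phik [Z [mZ Z0 Zu]]]]] := weighted_cauchy_subseq mw w0 mfu wC.
have uZ x : ~ Z x -> u_ (phi k) x @[k --> \oo] --> u x.
  by move=> nZ; apply: contrapT => /Zu.
have sqint_le (v : Rd -> R) (e : R) : form_domain v -> robin_form v v <= e ->
    (sqint mu2 (jump_part v) <= (2 * e)%:E)%E /\ (sqint mu (robin_part v) <= e%:E)%E.
  move=> Vv; have [_ jv rv] := Vv; rewrite -!dot_sqint// !lee_fin /robin_form.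
  by have := dot_ge0 mu2 (jump_part v); have := dot_ge0 mu (robin_part v); lra.
have close (e : R) : 0 < e -> exists N, forall n, (N <= n)%N ->
    (sqint mu2 (jump_part (lin (-1) u (u_ n))) <= (2 * e)%:E)%E /\
    (sqint mu (robin_part (lin (-1) u (u_ n))) <= e%:E)%E.
  move=> e0; have [N HN] := uC _ e0; exists N => n Nn.
  pose bound k (Nk : (N <= k)%N) := sqint_le _ _
    (form_domain_lin (-1) (Vu (phi k)) (Vu n)) (HN _ _ Nn (leq_trans Nk (phik k))).
  split.
  - apply: (@sqint_fatou _ _ _ mu2 (fun k => jump_part (lin (-1) (u_ (phi k)) (u_ n))) _ _ N).
    + by move=> k; apply: measurable_jump_part; exact: measurable_lin.
    + by apply: measurable_jump_part; exact: measurable_lin.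
    + have [mZ2 Z20] := negligible_fst_snd mZ Z0.
      exists (Z `*` setT `|` setT `*` Z); split => // z /= nz.
      apply: contrapT => nZz; apply: nz.
      have Z1 : ~ Z z.1 by move=> Zz; apply: nZz; left.
      have Z2 : ~ Z z.2 by move=> Zz; apply: nZz; right.
      rewrite /jump_part /lin; apply: cvgM; first exact: cvg_cst.
      by apply: cvgB; (apply: cvgD; last exact: cvg_cst); (apply: cvgM; first exact: cvg_cst); exact: uZ.
    + by move=> k Nk; case: (bound k Nk).
  - apply: (@sqint_fatou _ _ _ mu (fun k => robin_part (lin (-1) (u_ (phi k)) (u_ n))) _ _ N).
    + by move=> k; apply: measurable_robin_part; exact: measurable_lin.
    + by apply: measurable_robin_part; exact: measurable_lin.
    + exists Z; split => // z /= nz; apply: contrapT => nZz; apply: nz.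
      rewrite /robin_part /lin; apply: cvgM; first exact: cvg_cst.
      by apply: cvgD; last exact: cvg_cst; apply: cvgM; [exact: cvg_cst|exact: uZ].
    + by move=> k Nk; case: (bound k Nk).
have Vdiff n : (sqint mu2 (jump_part (lin (-1) u (u_ n))) < +oo)%E ->
    (sqint mu (robin_part (lin (-1) u (u_ n))) < +oo)%E -> form_domain (lin (-1) u (u_ n)).
  move=> j r; have ml : measurable_fun setT (lin (-1) u (u_ n)) by exact: measurable_lin.
  by split => //; split => //; [exact: measurable_jump_part|exact: measurable_robin_part].
have Vlim : form_domain u.
  have [N /(_ N (leqnn N))[jN rN]] := close _ (@ltr01 R).
  have := form_domain_lin (-1) (Vdiff N (le_lt_trans jN (ltry _)) (le_lt_trans rN (ltry _))) (Vu N).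
  by rewrite (_ : (fun x => _) = u)//; apply/funext => x; rewrite /lin; ring.
exists u => // e e0; have e2 : 0 < e / 2 by rewrite divr_gt0.
have [N HN] := close _ e2; exists N => n /HN[jn rn].
have Vd := Vdiff n (le_lt_trans jn (ltry _)) (le_lt_trans rn (ltry _)).
have [_ jd rd] := Vd; move: jn rn; rewrite -!dot_sqint// !lee_fin /robin_form; lra.
Qed.

End robin_form.

(** * Comparison of the form with the jump energy *)

Section robin_estimates.
Context {R : realType} {d : nat}.
Local Notation Rd := 'rV[R]_d.
Local Notation mu := (@lebesgue_rV R d).
Local Notation mu2 := (mu \x mu)%E.
Variables (nu : Rd -> R) (Omega : set Rd).
Hypotheses (nu_levy : levy_density nu) (oOmega : open Omega).
Let N0 := levy0 nu.
Let mOmega : measurable Omega := measurable_rV_open oOmega.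
Let mOc : measurable (~` Omega) := measurableC mOmega.

Lemma quad_energyE (u : Rd -> R) : quad_energy nu Omega setT u = jump_energy N0 Omega u.
Proof.
apply: eq_integral => x _; apply: eq_integral => y _.
have [xy|xy] := eqVneq (x - y) 0.
  by rewrite (subr0_eq xy) subrr expr0n /= !mul0r.
by rewrite /N0 levy0E.
Qed.

Lemma measurable_diagonal : measurable (@Defs.diagonal R d).
Proof.
rewrite (_ : Defs.diagonal = (fun z : Rd * Rd => z.1 - z.2) @^-1` [set 0]).
  rewrite -[X in measurable X]setTI; apply: measurable_rV_sub => //.
  by rewrite -[X in measurable X]setCK; apply: measurableC; exact: measurable_rV_set1C.
by apply/seteqP; split => -[x y]; rewrite /Defs.diagonal /=; [move=> ->; rewrite subrr|exact: subr0_eq].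
Qed.

Definition robin_region : set (Rd * Rd) := ~` ((~` Omega) `*` (~` Omega)).

Lemma measurable_robin_region : measurable robin_region.
Proof. by apply: measurableC; exact: measurableX. Qed.

Section kernel.
Variables (Lambda : R) (k : Rd -> Rd -> R).
Hypotheses (Lambda_ge1 : 1 <= Lambda) (k_ell : elliptic_kernel nu Lambda k).

(** Zero on the diagonal and on Omega^c x Omega^c: the integrals of the form then
    run over the whole product space. *)
Definition region_kernel : Rd * Rd -> R :=
  (fun z => k z.1 z.2) \_ (~` Defs.diagonal `&` robin_region).
Local Notation k0 := region_kernel.

Lemma measurable_region_kernel : measurable_fun setT k0.
Proof.
case: k_ell => mk _ _ _.
apply/(measurable_restrictT _ _).1.
  by apply: measurableI; [apply: measurableC; exact: measurable_diagonal|exact: measurable_robin_region].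
by apply: measurable_funS mk; [apply: measurableC; exact: measurable_diagonal|exact: subIsetl].
Qed.

Lemma region_kernel_ge0 z : 0 <= k0 z.
Proof.
case: k_ell => _ kp _ _; rewrite /k0 /patch; case: ifPn => // /set_mem[dz _].
by apply: kp; apply/eqP.
Qed.

Lemma energyE (u v : Rd -> R) :
  energy k Omega u v = 2^-1 * dot mu2 (jump_part k0 u) (jump_part k0 v).
Proof.
rewrite /energy /dot Rintegral_mkcond; congr (_ * _); apply: eq_Rintegral => z _.
rewrite /jump_part mulrACA -expr2 sqr_sqrtr ?region_kernel_ge0//.
rewrite /k0 /patch in_setI -/robin_region.
case: (boolP (z \in robin_region)) => _; rewrite ?andbF ?andbT ?mul0r//.
case: ifPn => [_|]; first by rewrite mulrC.
by rewrite in_setC negbK => /set_mem ->; rewrite subrr !mul0r.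
Qed.

Let F u (z : Rd * Rd) := ((u z.1 - u z.2) ^+ 2 * N0 (z.1 - z.2))%:E.

Let F0 u z : (0 <= F u z)%E.
Proof. by rewrite lee_fin; apply: mulr_ge0; [exact: sqr_ge0|exact: levy0_ge0]. Qed.

Let mF u : measurable_fun setT u -> measurable_fun setT (F u).
Proof.
move=> mfu; apply/measurable_EFinP/measurable_funM.
  apply: measurable_funX; apply: measurable_funB.
    exact: measurableT_comp mfu measurable_fst.
  exact: measurableT_comp mfu measurable_snd.
by apply: measurable_kernel_sub; exact: measurable_levy0.
Qed.

Let jump_part2 u z : jump_part k0 u z ^+ 2 = k0 z * (u z.1 - u z.2) ^+ 2.
Proof. by rewrite /jump_part exprMn sqr_sqrtr ?region_kernel_ge0. Qed.

Let Lambda_gt0 : 0 < Lambda := lt_le_trans ltr01 Lambda_ge1.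

Let kernel_low z : z.1 != z.2 -> robin_region z -> N0 (z.1 - z.2) <= Lambda * k0 z.
Proof.
move=> z12 zS; case: k_ell => _ _ _ /(_ _ _ z12)/andP[low _].
have z12' : z.1 - z.2 != 0 by rewrite subr_eq0.
rewrite /k0 /patch mem_set; last by split => //; exact/eqP.
rewrite -ler_pdivrMl//; apply: le_trans low.
by rewrite /N0 -(levy0_sym nu_levy) opprB levy0E// -oppr_eq0 opprB.
Qed.

Let kernel_up z : z.1 != z.2 -> k0 z <= Lambda * N0 (z.1 - z.2).
Proof.
move=> z12; rewrite /k0 /patch; case: ifPn => _; last first.
  by apply: mulr_ge0; [exact: ltW|exact: levy0_ge0].
case: k_ell => _ _ _ /(_ _ _ z12)/andP[_ up]; apply: le_trans up _.
have z12' : z.1 - z.2 != 0 by rewrite subr_eq0.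
by rewrite /N0 -(levy0_sym nu_levy) opprB levy0E// -oppr_eq0 opprB.
Qed.

Let mj2 u : measurable_fun setT u -> measurable_fun setT (fun z => (jump_part k0 u z ^+ 2)%:E).
Proof.
move=> mfu; apply: measurable_sqr; apply: measurable_jump_part => //.
exact: measurable_region_kernel.
Qed.

Lemma jump_le_form (u : Rd -> R) : measurable_fun setT u ->
  (jump_energy N0 Omega u <= Lambda%:E * sqint mu2 (jump_part k0 u))%E.
Proof.
move=> mfu.
have mOT : measurable (Omega `*` [set: Rd]) by exact: measurableX.
rewrite /jump_energy -(tonelli_setX mu mu (mF mfu) (F0 u) mOmega measurableT).
rewrite /sqint -ge0_integralZl_EFin//; last 3 first.
- by move=> z _; rewrite lee_fin sqr_ge0.
- exact: mj2.
- exact: ltW.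
have mL : measurable_fun setT (fun z => Lambda%:E * (jump_part k0 u z ^+ 2)%:E)%E.
  by apply: emeasurable_funM => //; exact: mj2.
have L0 z : (0 <= Lambda%:E * (jump_part k0 u z ^+ 2)%:E)%E.
  by apply: mule_ge0; rewrite lee_fin ?sqr_ge0// ltW.
apply: (@le_trans _ _ (\int[mu2]_(z in Omega `*` setT) (Lambda%:E * (jump_part k0 u z ^+ 2)%:E))%E).
  apply: ge0_le_integral => //.
  - by apply: measurable_funTS; exact: mF.
  - exact: measurable_funTS.
  move=> z [zO _]; rewrite -EFinM lee_fin jump_part2.
  have [->|z12] := eqVneq z.1 z.2; first by rewrite subrr expr0n /= mul0r !mulr0.
  rewrite mulrA mulrC ler_wpM2r ?sqr_ge0// kernel_low//.
  by move=> [/(_ zO)].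
by apply: ge0_subset_integral.
Qed.

(** The region is the union of Omega x R^d and its mirror image, and the integrand
    is symmetric, whence the factor 2. *)
Lemma form_le_jump (u : Rd -> R) : measurable_fun setT u ->
  (sqint mu2 (jump_part k0 u) <= (2 * Lambda)%:E * jump_energy N0 Omega u)%E.
Proof.
move=> mfu.
have mOT : measurable (Omega `*` [set: Rd]) by exact: measurableX.
have mTO : measurable ([set: Rd] `*` Omega) by exact: measurableX.
have mp (D : set (Rd * Rd)) : measurable D -> measurable_fun setT ((F u) \_ D).
  by move=> mD; apply/(measurable_restrictT _ _).1 => //; apply: measurable_funTS; exact: mF.
have p0 (D : set (Rd * Rd)) z : (0 <= ((F u) \_ D) z)%E by rewrite /patch; case: ifP.
have I1 : (\int[mu2]_z ((F u) \_ (Omega `*` setT)) z = jump_energy N0 Omega u)%E.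
  by rewrite -integral_mkcond; exact: (tonelli_setX mu mu (mF mfu) (F0 u) mOmega measurableT).
have I2 : (\int[mu2]_z ((F u) \_ (setT `*` Omega)) z = jump_energy N0 Omega u)%E.
  rewrite -integral_mkcond (tonelli_setX mu mu (mF mfu) (F0 u) measurableT mOmega).
  rewrite (tonelli_setX_swap mu mu (mF mfu) (F0 u) measurableT mOmega).
  apply: eq_integral => x _; apply: eq_integral => y _.
  by rewrite /F /N0 /= -(opprB (u x)) sqrrN -(levy0_sym nu_levy) opprB.
have -> : ((2 * Lambda)%:E * jump_energy N0 Omega u =
  \int[mu2]_z (Lambda%:E * (((F u) \_ (Omega `*` setT)) z + ((F u) \_ (setT `*` Omega)) z)))%E.
  rewrite ge0_integralZl_EFin//; last 3 first.
  - by move=> z _; rewrite adde_ge0.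
  - by apply: emeasurable_funD; exact: mp.
  - exact: ltW.
  rewrite ge0_integralD//; [|exact: mp..].
  rewrite I1 I2 mulrC EFinM -muleA; congr (_ * _)%E.
  by rewrite -[2]/(1 + 1)%R EFinD ge0_muleDl ?lee_fin// !mul1e.
apply: ge0_le_integral => //.
- by move=> z _; rewrite lee_fin sqr_ge0.
- exact: mj2.
- by apply: emeasurable_funM => //; apply: emeasurable_funD; exact: mp.
move=> z _; rewrite jump_part2.
have [z12|z12] := eqVneq z.1 z.2.
  rewrite z12 subrr expr0n /= mulr0; apply: mule_ge0; first by rewrite lee_fin ltW.
  exact: adde_ge0.
have [zS|zS] := pselect (robin_region z); last first.
  rewrite /k0 /patch memNset; last by move=> [].
  rewrite mul0r; apply: mule_ge0; first by rewrite lee_fin ltW.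
  by apply: adde_ge0; exact: p0.
apply: (@le_trans _ _ (Lambda%:E * F u z)%E).
  by rewrite /F -EFinM lee_fin [leRHS]mulrCA [leLHS]mulrC ler_wpM2l ?sqr_ge0// kernel_up.
rewrite lee_wpmul2l ?lee_fin ?(ltW Lambda_gt0)//.
have [zO|zO] := pselect (Omega z.1).
  rewrite (_ : ((F u) \_ (Omega `*` setT)) z = F u z); first exact: leeDl.
  by rewrite /patch mem_set.
have zO2 : Omega z.2 by apply: contrapT => zO2; apply: zS.
rewrite (_ : ((F u) \_ (setT `*` Omega)) z = F u z); first exact: leeDr.
by rewrite /patch mem_set.
Qed.

End kernel.
End robin_estimates.

(** * The Robin problem *)

Section robin_problem.
Context {R : realType} {d : nat}.
Local Notation Rd := 'rV[R]_d.
Local Notation mu := (@lebesgue_rV R d).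
Local Notation mu2 := (mu \x mu)%E.
Variables (Omega B : set Rd) (nu beta : Rd -> R) (Lambda : R).
Hypotheses (Omega_open : open Omega) (Omega_bounded : bounded_set Omega)
  (B_open : open B) (B_nonempty : B !=set0) (B_sub : B `<=` Omega)
  (nu_levy : levy_density nu) (nu_full : full_support nu)
  (Lambda_ge1 : 1 <= Lambda)
  (beta_meas : measurable_fun (~` Omega) beta)
  (beta_ge0 : forall y, (~` Omega) y -> 0 <= beta y)
  (beta_bounded : exists M : R, {ae mu, forall y,
     (~` Omega) y -> `|beta y * (nu_tilde nu B y)^-1| <= M})
  (beta_pos : (0 < mu (~` Omega `&` [set y | (0 < beta y)%R]))%E).
Let N0 := levy0 nu.
Let m := levy_trunc nu.
Let mOmega : measurable Omega := measurable_rV_open Omega_open.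
Let mOc : measurable (~` Omega) := measurableC mOmega.
Let mB : measurable B := measurable_rV_open B_open.
Let mm : measurable_fun setT m := measurable_levy_trunc nu_levy.
Let m_ge0 := levy_trunc_ge0 nu_levy.
Let m_le1 : forall h, m h <= 1 := @levy_trunc_le1 _ _ nu.
Let m_sym := levy_trunc_sym nu_levy.
Let m_fin := levy_trunc_fin nu_levy.
Let m_pos := levy_trunc_pos nu_levy nu_full.
Let mN0 : measurable_fun setT N0 := measurable_levy0 nu_levy.
Let m_le_N0 : forall h, m h <= N0 h := @levy_trunc_le _ _ nu.

(** This agrees with nu_tilde outside Omega; unlike nu_tilde it is defined from
    the density normalised at the origin, so it is well behaved on all of R^d. *)
Definition weight (x : Rd) : R := fine (kconv m B x).

Lemma weightE x : (weight x)%:E = kconv m B x.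
Proof.
rewrite /weight fineK// ge0_fin_numE; last exact: kconv_ge0.
exact: le_lt_trans (kconv_le mm m_ge0 _ mB) m_fin.
Qed.

Lemma weight_gt0 x : 0 < weight x.
Proof. by rewrite -lte_fin weightE; exact: kconv_open_pos. Qed.

Lemma measurable_weight : measurable_fun setT weight.
Proof.
apply: measurableT_comp; first exact: fine_measurable.
have mk : measurable_fun setT (fun z : Rd * Rd => (m (z.1 - z.2))%:E).
  by apply/measurable_EFinP; exact: measurable_kernel_sub.
by apply: (measurable_fun_integral_dom mu mk _ mB) => z; rewrite lee_fin m_ge0.
Qed.

Lemma nu_tildeE y : (~` Omega) y -> nu_tilde nu B y = weight y.
Proof.
move=> Oy; apply: eq_Rintegral => x /set_mem Bx.
rewrite /m /levy_trunc levy0E// subr_eq0; apply/eqP => yx.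
by apply: Oy; rewrite yx; exact: B_sub.
Qed.

Definition ext_beta : Rd -> R := beta \_ (~` Omega).

Lemma measurable_ext_beta : measurable_fun setT ext_beta.
Proof. exact/(measurable_restrictT _ _).1. Qed.

Lemma ext_beta_ge0 y : 0 <= ext_beta y.
Proof. by rewrite /ext_beta /patch; case: ifPn => // /set_mem; exact: beta_ge0. Qed.

Let robin_part2 u y : robin_part ext_beta u y ^+ 2 = ext_beta y * u y ^+ 2.
Proof. by rewrite /robin_part exprMn sqr_sqrtr// ext_beta_ge0. Qed.

Lemma sqint_robin_part (u : Rd -> R) :
  sqint mu (robin_part ext_beta u) = (\int[mu]_(y in ~` Omega) (u y ^+ 2 * beta y)%:E)%E.
Proof.
rewrite /sqint [RHS]integral_mkcond; apply: eq_integral => y _.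
rewrite robin_part2 /ext_beta /patch; case: ifP => _; first by rewrite mulrC.
by rewrite mul0r.
Qed.

Definition weighted_sqint (u : Rd -> R) : \bar R := (\int[mu]_x (u x ^+ 2 * weight x)%:E)%E.
Definition Omega_sqint (u : Rd -> R) : \bar R := (\int[mu]_(x in Omega) (u x ^+ 2)%:E)%E.

Let wfun_ge0 (u : Rd -> R) x : (0 <= (u x ^+ 2 * weight x)%:E)%E.
Proof. by rewrite lee_fin; apply: mulr_ge0; [exact: sqr_ge0|exact/ltW/weight_gt0]. Qed.

Let mwfun (u : Rd -> R) : measurable_fun setT u ->
  measurable_fun setT (fun x => (u x ^+ 2 * weight x)%:E).
Proof.
move=> mfu; apply/measurable_EFinP/measurable_funM; last exact: measurable_weight.
exact: measurable_funX.
Qed.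

Lemma robin_le_weight : exists2 M : R, 0 <= M & forall u, measurable_fun setT u ->
  (sqint mu (robin_part ext_beta u) <= M%:E * weighted_sqint u)%E.
Proof.
have [M HM] := beta_bounded; exists `|M| => // u mfu.
rewrite sqint_robin_part.
apply: (@le_trans _ _ (\int[mu]_(x in ~` Omega) (`|M|%:E * (u x ^+ 2 * weight x)%:E))%E).
  apply: ae_ge0_le_integral => //.
  - by move=> y Oy; rewrite lee_fin; apply: mulr_ge0; [exact: sqr_ge0|exact: beta_ge0].
  - apply/measurable_EFinP/measurable_funM => //.
    by apply: measurable_funTS; exact: measurable_funX.
  - by move=> y _; apply: mule_ge0.
  - by apply: measurable_funTS; apply: emeasurable_funM => //; exact: mwfun.
  apply: filterS HM => y HM Oy; rewrite -EFinM lee_fin mulrCA ler_wpM2l ?sqr_ge0//.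
  have := HM Oy; rewrite nu_tildeE// normrM normfV (gtr0_norm (weight_gt0 y)).
  rewrite ler_pdivrMr ?weight_gt0// => /(le_trans (ler_norm _))/le_trans; apply.
  by rewrite ler_wpM2r ?(ltW (weight_gt0 y))// ler_norm.
rewrite ge0_integralZl_EFin//; last by apply: measurable_funTS; exact: mwfun.
by rewrite lee_wpmul2l//; apply: ge0_subset_integral => //; exact: mwfun.
Qed.

(** The squared V norm, extended-valued so that estimates hold for every
    measurable u and finiteness is read off at the end. *)
Definition Vsq (u : Rd -> R) : \bar R := (Omega_sqint u + jump_energy N0 Omega u)%E.

Lemma weighted_sqint_le_Vsq : exists2 C : R, 0 < C & forall u, measurable_fun setT u ->
  (weighted_sqint u <= C%:E * Vsq u)%E.
Proof.
pose M := fine (\int[mu]_h (m h)%:E)%E.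
have M0 : 0 <= M by apply: fine_ge0; apply: integral_ge0 => h _; rewrite lee_fin m_ge0.
exists (2 + 2 * M); first by rewrite ltr_pwDl// mulr_ge0.
move=> u mfu.
have := weighted_trace mm m_ge0 m_sym m_fin mN0 m_le_N0 Omega_open mB B_sub mfu.
rewrite /weighted_sqint; under eq_integral do rewrite -weightE -EFinM.
move=> /le_trans; apply.
have j0 : (0 <= jump_energy N0 Omega u)%E by exact: jump_ge0 m_ge0 m_le_N0 _ _.
have o0 : (0 <= Omega_sqint u)%E by apply: integral_ge0 => x _; rewrite lee_fin sqr_ge0.
have -> : (2 + 2 * M)%:E = (2%:E + (2 * M)%:E)%E by rewrite EFinD.
rewrite -/M ge0_muleDl ?lee_fin ?mulr_ge0//; apply: leeD.
  by rewrite lee_wpmul2l// leeDr.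
by rewrite lee_wpmul2l ?lee_fin ?mulr_ge0// leeDl.
Qed.

Let jump0 u : (0 <= jump_energy N0 Omega u)%E.
Proof. exact: jump_ge0 m_ge0 m_le_N0 _ _. Qed.

Let Omega_sqint0 u : (0 <= Omega_sqint u)%E.
Proof. by apply: integral_ge0 => x _; rewrite lee_fin sqr_ge0. Qed.

Let lee_addM (a b : R) (X Y Z : \bar R) : 0 <= a -> 0 <= b -> (0 <= Z)%E ->
  (X <= a%:E * Z -> Y <= b%:E * Z -> X + Y <= (a + b)%:E * Z)%E.
Proof. by move=> a0 b0 Z0 XZ YZ; rewrite EFinD ge0_muleDl ?lee_fin// leeD. Qed.

Local Notation kernel k := (region_kernel Omega k).

Definition form_sqint (k : Rd -> Rd -> R) (u : Rd -> R) : \bar R :=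
  (2^-1%:E * sqint mu2 (jump_part (kernel k) u) + sqint mu (robin_part ext_beta u))%E.

Lemma Vsq_le_form : exists2 C : R, 0 < C & forall k u, elliptic_kernel nu Lambda k ->
  measurable_fun setT u -> (Vsq u <= C%:E * form_sqint k u)%E.
Proof.
have O0 : Omega !=set0 by case: B_nonempty => x Bx; exists x; exact: B_sub.
have [C1 C10 HC1] := friedrichs mm m_ge0 m_le1 m_sym m_fin m_pos mN0 m_le_N0
  Omega_open Omega_bounded O0 beta_meas beta_ge0 beta_pos.
have L0 : 0 < Lambda by exact: lt_le_trans Lambda_ge1.
have C1L : 0 < C1 * (2 * Lambda + 1) + 2 * Lambda.
  by rewrite addr_gt0 ?mulr_gt0// addr_gt0// mulr_gt0.
exists (C1 * (2 * Lambda + 1) + 2 * Lambda) => // k u kE mfu.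
set E := form_sqint k u.
have J0 : (0 <= 2^-1%:E * sqint mu2 (jump_part (kernel k) u))%E.
  by apply: mule_ge0; [rewrite lee_fin|exact: sqint_ge0].
have R0 := sqint_ge0 mu (robin_part ext_beta u).
have E0 : (0 <= E)%E by exact: adde_ge0.
have jE : (jump_energy N0 Omega u <= (2 * Lambda)%:E * E)%E.
  apply: (le_trans (jump_le_form nu_levy Omega_open Lambda_ge1 kE mfu)).
  have -> : (Lambda%:E * sqint mu2 (jump_part (kernel k) u) =
    (2 * Lambda)%:E * (2^-1%:E * sqint mu2 (jump_part (kernel k) u)))%E.
    by rewrite muleA -EFinM mulrAC divff ?mul1r.
  by rewrite lee_wpmul2l ?lee_fin ?mulr_ge0 ?(ltW L0)// leeDl.
have jRE : (jump_energy N0 Omega u + sqint mu (robin_part ext_beta u) <= (2 * Lambda + 1)%:E * E)%E.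
  by apply: lee_addM => //; [rewrite mulr_ge0// ltW|rewrite mul1e leeDr].
apply: lee_addM => //.
- by rewrite mulr_ge0 ?(ltW C10)// addr_ge0// mulr_ge0// ltW.
- by rewrite mulr_ge0// ltW.
apply: (le_trans (HC1 u mfu)); rewrite -sqint_robin_part EFinM -muleA.
by rewrite lee_wpmul2l// lee_fin ltW.
Qed.

Lemma inVE u : inV nu Omega u <-> measurable_fun setT u /\ (Vsq u < +oo)%E.
Proof.
have E : (\int[mu]_(x in Omega) (u x ^+ 2 * cst 1 x)%:E)%E = Omega_sqint u.
  by apply: eq_integral => x _; rewrite /= mulr1.
split=> [[mfu [_]]|[mfu V]].
  by rewrite E quad_energyE => o q; split => //; exact: lte_add_pinfty.
split => //; last by rewrite quad_energyE; apply: le_lt_trans V; exact: leeDr.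
split; first exact: measurable_funTS.
by rewrite E; apply: le_lt_trans V; exact: leeDl.
Qed.

Lemma inV_form_domain k u : elliptic_kernel nu Lambda k ->
  inV nu Omega u <-> form_domain (kernel k) ext_beta u.
Proof.
move=> kE; rewrite inVE; split=> [[mfu V]|[mfu [_ j] [_ r]]]; last first.
  split => //; have [C C0 /(_ k u kE mfu) H] := Vsq_le_form.
  apply: (le_lt_trans H); apply: lte_mul_pinfty => //; first by rewrite lee_fin ltW.
  by apply: lte_add_pinfty => //; apply: lte_mul_pinfty => //; rewrite lee_fin.
have [fo fj] : (Omega_sqint u < +oo)%E /\ (jump_energy N0 Omega u < +oo)%E.
  by split; apply: le_lt_trans V; [exact: leeDl|exact: leeDr].
have L0 : 0 <= Lambda by exact: le_trans Lambda_ge1.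
split => //; split.
- by apply: measurable_jump_part => //; exact: measurable_region_kernel kE.
- apply: (le_lt_trans (form_le_jump nu_levy Omega_open Lambda_ge1 kE mfu)).
  by apply: lte_mul_pinfty => //; rewrite lee_fin mulr_ge0.
- by apply: measurable_robin_part => //; exact: measurable_ext_beta.
have [M M0 /(_ u mfu) H] := robin_le_weight.
apply: (le_lt_trans H); apply: lte_mul_pinfty => //.
have [C C0 /(_ u mfu) H'] := weighted_sqint_le_Vsq.
apply: (le_lt_trans H'); apply: lte_mul_pinfty => //; first by rewrite lee_fin ltW.
Qed.

Lemma Vnorm_sqr u : inV nu Omega u -> (Vnorm nu Omega u ^+ 2)%:E = Vsq u.
Proof.
move=> /inVE[mfu V].
have [fo fj] : (Omega_sqint u < +oo)%E /\ (jump_energy N0 Omega u < +oo)%E.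
  by split; apply: le_lt_trans V; [exact: leeDl|exact: leeDr].
have o1 : \int[mu]_(x in Omega) (u x ^+ 2 * cst 1 x) = fine (Omega_sqint u).
  by congr fine; apply: eq_integral => x _; rewrite /= mulr1.
rewrite /Vnorm /L2norm o1 quad_energyE !sqr_sqrtr ?fine_ge0 ?addr_ge0 ?fine_ge0//.
by rewrite EFinD !fineK// ge0_fin_numE.
Qed.

Definition robin_functional (f g v : Rd -> R) : R :=
  \int[mu]_(x in Omega) (f x * v x) + \int[mu]_(y in ~` Omega) (g y * v y).

Let dom_part (v : Rd -> R) (x : Rd) : R := \1_Omega x * v x.
Let ext_part (v : Rd -> R) (x : Rd) : R := Num.sqrt (weight x) * v x.

Let measurable_dom_part v : measurable_fun setT v -> measurable_fun setT (dom_part v).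
Proof. by move=> mv; apply: measurable_funM => //; exact: measurable_indic. Qed.

Let measurable_ext_part v : measurable_fun setT v -> measurable_fun setT (ext_part v).
Proof.
move=> mv; apply: measurable_funM => //; apply: measurableT_comp measurable_weight.
by apply: continuous_measurable_fun; exact: sqrt_continuous.
Qed.

Let sqint_dom_part v : sqint mu (dom_part v) = Omega_sqint v.
Proof.
rewrite /Omega_sqint [RHS]integral_mkcond; apply: eq_integral => x _.
rewrite /dom_part indicE /patch; case: (x \in Omega); rewrite ?mul1r ?mul0r//.
by rewrite expr0n.
Qed.

Let sqint_ext_part v : sqint mu (ext_part v) = weighted_sqint v.
Proof.
apply: eq_integral => x _; rewrite /ext_part exprMn sqr_sqrtr ?ltW ?weight_gt0//.
by rewrite mulrC.
Qed.

Let isL2_parts v : inV nu Omega v -> isL2 mu (dom_part v) /\ isL2 mu (ext_part v).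
Proof.
move=> /inVE[mv V]; split; split.
- exact: measurable_dom_part.
- by rewrite sqint_dom_part; apply: le_lt_trans V; exact: leeDl.
- exact: measurable_ext_part.
have [C C0 /(_ v mv) H] := weighted_sqint_le_Vsq.
rewrite sqint_ext_part; apply: (le_lt_trans H).
by apply: lte_mul_pinfty => //; rewrite lee_fin ltW.
Qed.

(** The weight 1 / nu_tilde of the norm of g is compensated by sqrt(weight) on v,
    so that the functional becomes a sum of L2 inner products with functions whose
    norms are those of f and g. *)
Lemma robin_functional_repr f g : inL2 Omega (cst 1) f ->
  inL2 (~` Omega) (fun y => (nu_tilde nu B y)^-1) g ->
  exists f1 g1 : Rd -> R, [/\ isL2 mu f1, isL2 mu g1,
    dot mu f1 f1 = L2norm Omega (cst 1) f ^+ 2,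
    dot mu g1 g1 = L2norm (~` Omega) (fun y => (nu_tilde nu B y)^-1) g ^+ 2 &
    forall v, robin_functional f g v = dot mu f1 (dom_part v) + dot mu g1 (ext_part v)].
Proof.
move=> [mf f2] [mg g2].
pose f1 := f \_ Omega.
pose rw (y : Rd) := Num.sqrt ((weight y)^-1).
pose g1 y := (g \_ (~` Omega)) y * rw y.
have rw2 y : rw y ^+ 2 = (weight y)^-1.
  by rewrite sqr_sqrtr// invr_ge0 ltW// weight_gt0.
have rww y : rw y * Num.sqrt (weight y) = 1.
  rewrite /rw sqrtrV ?ltW ?weight_gt0// mulVf// gt_eqF// sqrtr_gt0.
  exact: weight_gt0.
have mrw : measurable_fun setT rw.
  apply: measurableT_comp.
    by apply: continuous_measurable_fun; exact: sqrt_continuous.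
  rewrite (_ : (fun y => _) = (fun y => powR (weight y) (-1))); last first.
    by apply/funext => y; rewrite powR_inv1 ?ltW ?weight_gt0.
  by apply: (measurableT_comp (f := fun x : R => powR x (-1))) measurable_weight; exact: measurable_powR.
have f1E : sqint mu f1 = (\int[mu]_(x in Omega) (f x ^+ 2 * cst 1 x)%:E)%E.
  rewrite /sqint [RHS]integral_mkcond; apply: eq_integral => x _.
  by rewrite /f1 /patch /=; case: ifP => _; rewrite ?mulr1 ?expr0n.
have g1E : sqint mu g1 = (\int[mu]_(x in ~` Omega) (g x ^+ 2 * (nu_tilde nu B x)^-1)%:E)%E.
  rewrite /sqint [RHS]integral_mkcond; apply: eq_integral => x _.
  rewrite /g1 /patch exprMn rw2; case: ifPn => [/set_mem xO|_].
    by rewrite nu_tildeE.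
  by rewrite expr0n mul0r.
have Lf1 : isL2 mu f1.
  by split; [exact/(measurable_restrictT _ _).1|rewrite f1E].
have Lg1 : isL2 mu g1.
  split; last by rewrite g1E.
  by apply: measurable_funM => //; exact/(measurable_restrictT _ _).1.
exists f1, g1; split => //.
- rewrite /L2norm sqr_sqrtr; last first.
    by apply: Rintegral_ge0 => x _; rewrite mulr1 sqr_ge0.
  by apply: EFin_inj; rewrite dot_sqint// f1E /Rintegral fineK// -f1E -dot_sqint.
- rewrite /L2norm sqr_sqrtr; last first.
    apply: Rintegral_ge0 => x Ox; apply: mulr_ge0; first exact: sqr_ge0.
    by rewrite nu_tildeE// invr_ge0 ltW// weight_gt0.
  by apply: EFin_inj; rewrite dot_sqint// g1E /Rintegral fineK// -g1E -dot_sqint.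
move=> v; rewrite /robin_functional /dot; congr (_ + _).
  rewrite Rintegral_mkcond; apply: eq_Rintegral => x _.
  by rewrite /f1 /dom_part indicE /patch; case: ifP => xO; rewrite ?mul1r ?mul0r.
rewrite Rintegral_mkcond; apply: eq_Rintegral => x _.
rewrite /g1 /ext_part [_ * v x]mulrC mulrACA rww mulr1 /patch.
by case: ifP => _; rewrite ?mul0r.
Qed.

Lemma energy_robin_form k u v : elliptic_kernel nu Lambda k ->
  energy k Omega u v + \int[mu]_(y in ~` Omega) (u y * v y * beta y) =
  robin_form (kernel k) ext_beta u v.
Proof.
move=> kE; rewrite (energyE Omega kE) /robin_form; congr (_ + _).
rewrite /dot Rintegral_mkcond; apply: eq_Rintegral => y _.
rewrite /robin_part mulrACA -expr2 sqr_sqrtr ?ext_beta_ge0// /ext_beta /patch.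
by case: ifP => _; rewrite ?mul0r// mulrC.
Qed.

(** Existence by riesz_representation; the constants come from Vsq_le_form and
    weighted_sqint_le_Vsq, in which k enters only through Lambda. *)
Lemma robin_wellposed : exists2 C : R, 0 < C &
  forall (k : Rd -> Rd -> R) (f g : Rd -> R),
    elliptic_kernel nu Lambda k ->
    inL2 Omega (cst 1) f ->
    inL2 (~` Omega) (fun y => (nu_tilde nu B y)^-1) g ->
    exists u : Rd -> R,
      [/\ robin_weak_solution nu k Omega beta f g u,
          forall u', robin_weak_solution nu k Omega beta f g u' ->
            ae_eq_on setT u' u &
          Vnorm nu Omega u <= C * (L2norm Omega (cst 1) f +
            L2norm (~` Omega) (fun y => (nu_tilde nu B y)^-1) g)].
Proof.
have [C0 C00 HC0] := Vsq_le_form; have [C1 C10 HC1] := weighted_sqint_le_Vsq.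
pose K0 := C0 * (1 + C1).
have K00 : 0 <= K0 by rewrite mulr_ge0 ?addr_ge0// ltW.
have C0K0 : 0 <= 2 * C0 * K0 by apply: mulr_ge0 => //; apply: mulr_ge0 => //; exact: ltW.
exists (1 + 2 * C0 * K0); first by rewrite ltr_pwDl.
move=> k f g kE f2 g2.
have [f1 [g1 [Lf1 Lg1 f1E g1E lE]]] := robin_functional_repr f2 g2.
set Fn := L2norm _ _ f in f1E *; set Gn := L2norm _ _ g in g1E *.
have Fn0 : 0 <= Fn by exact: sqrtr_ge0.
have Gn0 : 0 <= Gn by exact: sqrtr_ge0.
pose V := form_domain (kernel k) ext_beta.
pose a := robin_form (kernel k) ext_beta.
pose l := robin_functional f g.
have VE u : inV nu Omega u <-> V u by exact: inV_form_domain.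
have mV u : V u -> measurable_fun setT u by case.
have aE u : V u -> form_sqint k u = (a u u)%:E by move=> Vu; rewrite /a robin_formE.
have Va u : V u -> (Vsq u <= (C0 * a u u)%:E)%E.
  by move=> Vu; rewrite EFinM -aE//; apply: HC0 => //; exact: mV.
have wa u : V u -> (weighted_sqint u <= (C1 * C0 * a u u)%:E)%E.
  move=> Vu; apply: (le_trans (HC1 _ (mV _ Vu))); rewrite -mulrA EFinM.
  by rewrite lee_wpmul2l ?lee_fin ?(ltW C10)// Va.
have parts u : V u -> dot mu (dom_part u) (dom_part u) + dot mu (ext_part u) (ext_part u)
    <= K0 * a u u.
  move=> Vu; have [Ld Le] := isL2_parts ((VE u).2 Vu).
  have -> : K0 * a u u = C0 * a u u + C1 * C0 * a u u by rewrite /K0; ring.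
  apply: lerD.
    rewrite -lee_fin dot_sqint// sqint_dom_part; apply: le_trans (Va _ Vu).
    exact: leeDl.
  by rewrite -lee_fin dot_sqint// sqint_ext_part wa.
pose K := 2 * (Fn ^+ 2 + Gn ^+ 2) * K0.
have K_ge0 : 0 <= K.
  by apply: mulr_ge0 => //; apply: mulr_ge0 => //; apply: addr_ge0; exact: sqr_ge0.
have lK v : V v -> l v ^+ 2 <= K * a v v.
  move=> Vv; have [Ld Le] := isL2_parts ((VE v).2 Vv).
  rewrite /l lE; have := dot_cauchy_schwarz Lf1 Ld; have := dot_cauchy_schwarz Lg1 Le.
  have := parts v Vv; have := dot_ge0 mu (dom_part v); have := dot_ge0 mu (ext_part v).
  rewrite f1E g1E /K.
  move: (dot mu f1 _) (dot mu g1 _) (dot mu _ _) (dot mu _ _) => p q P Q P0 Q0 PQ hq hp.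
  have h : (p + q) ^+ 2 <= 2 * (p ^+ 2 + q ^+ 2) by have := sqr_ge0 (p - q); nra.
  apply: (le_trans h); rewrite -[leRHS]mulrA -[leRHS]mulrA ler_wpM2l//.
  have FG0 : 0 <= Fn ^+ 2 + Gn ^+ 2 by apply: addr_ge0; exact: sqr_ge0.
  apply: (@le_trans _ _ ((Fn ^+ 2 + Gn ^+ 2) * (P + Q))); last by rewrite ler_wpM2l.
  have := sqr_ge0 Fn; have := sqr_ge0 Gn; nra.
have lL t u v : V u -> V v -> l (fun x => t * u x + v x) = t * l u + l v.
  move=> Vu Vv; have [Ldu Leu] := isL2_parts ((VE u).2 Vu).
  have [Ldv Lev] := isL2_parts ((VE v).2 Vv).
  rewrite /l !lE.
  have -> : dom_part (fun x => t * u x + v x) = fun x => t * dom_part u x + dom_part v x.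
    by apply/funext => x; rewrite /dom_part; ring.
  have -> : ext_part (fun x => t * u x + v x) = fun x => t * ext_part u x + ext_part v x.
    by apply/funext => x; rewrite /ext_part; ring.
  by rewrite (dotR t Ldu Ldv Lf1) (dotR t Leu Lev Lg1); ring.
have mk0 := measurable_region_kernel Omega_open kE.
have complete := form_domain_complete mk0 measurable_ext_beta measurable_weight
  weight_gt0 (mulr_gt0 C10 C00) wa.
have V0 : exists u, V u.
  exists (fun=> 0); apply/VE/inVE; split; first exact: measurable_cst.
  rewrite /Vsq /Omega_sqint /jump_energy !integral0_eq ?adde0 ?ltry// => x _; last by rewrite expr0n.
  by apply: integral0_eq => y _; rewrite subrr expr0n mul0r.
have [u Vu uP] := @riesz_representation _ _ V a (form_domain_lin (k0 := kernel k) (beta0 := ext_beta))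
  (fun u v _ _ => robin_formC _ _ u v) (robin_formL (k0 := kernel k) (beta0 := ext_beta))
  (fun u _ => robin_form_ge0 _ _ u) l K V0 lL lK K_ge0 complete.
exists u; split.
- split; first exact/VE.
  by move=> v /VE Vv; rewrite energy_robin_form//; exact: uP.
- move=> u' [/VE Vu' u'P].
  pose h : Rd -> R := fun x => -1 * u x + u' x.
  have Vh : V h by exact: form_domain_lin.
  have ah : a h h = 0.
    have u'h : a u' h = l h.
      by rewrite /a -energy_robin_form//; apply: u'P; exact/VE.
    by rewrite {1}/h /a robin_formL// -/(a u h) -/(a u' h) uP// u'h mulN1r addNr.
  have wh : weighted_sqint h = 0%E.
    apply/eqP; rewrite eq_le; apply/andP; split; last exact: integral_ge0.
    by apply: (le_trans (wa _ Vh)); rewrite ah mulr0.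
  have mwh := mwfun (mV _ Vh).
  have : (\int[mu]_x `|(h x ^+ 2 * weight x)%:E| = 0)%E.
    by rewrite -[RHS]wh; apply: eq_integral => x _; rewrite gee0_abs.
  move=> /(ae_eq_integral_abs mu measurableT mwh); apply: filterS => x /(_ I) /= [] /eqP.
  rewrite mulf_eq0 (gt_eqF (weight_gt0 x)) orbF sqrf_eq0 /h mulN1r addrC subr_eq0.
  by move=> /eqP.
have auK : a u u <= K.
  have := lK _ Vu; rewrite -uP// expr2.
  have [->//|au0] := eqVneq (a u u) 0.
  by rewrite ler_pM2r// lt_neqAle eq_sym au0 robin_form_ge0.
rewrite -(@ler_pXn2r _ 2)// ?nnegrE ?sqrtr_ge0//; last first.
  by rewrite mulr_ge0 ?addr_ge0.
rewrite -lee_fin Vnorm_sqr; last exact/VE.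
apply: (le_trans (Va _ Vu)); rewrite lee_fin.
apply: (@le_trans _ _ (C0 * K)); first by rewrite ler_wpM2l// ltW.
have -> : C0 * K = (2 * C0 * K0) * (Fn ^+ 2 + Gn ^+ 2) by rewrite /K; ring.
rewrite exprMn; apply: ler_pM => //.
- by rewrite addr_ge0// sqr_ge0.
- by have := C0K0; nra.
- by have := mulr_ge0 Fn0 Gn0; nra.
Qed.

End robin_problem.

Theorem theorem4p16 (R : realType) (d : nat)
  (Omega B : set 'rV[R]_d) (nu beta : 'rV[R]_d -> R) (Lambda : R)
  (Omega_open : open Omega) (Omega_bounded : bounded_set Omega)
  (B_open : open B) (B_nonempty : B !=set0) (B_sub : B `<=` Omega)
  (nu_levy : levy_density nu) (nu_full : full_support nu)
  (nu_Omega : class_A1 nu Omega \/ class_A2 nu Omega \/ class_A3 nu Omega)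
  (Lambda_ge1 : 1 <= Lambda)
  (beta_meas : measurable_fun (~` Omega) beta)
  (beta_ge0 : forall y, (~` Omega) y -> 0 <= beta y)
  (beta_bounded : exists M : R, {ae lebesgue_rV d, forall y,
     (~` Omega) y -> `|beta y * (nu_tilde nu B y)^-1| <= M})
  (beta_pos : (0 < lebesgue_rV d (~` Omega `&` [set y | (0 < beta y)%R]))%E) :
  exists2 C : R, 0 < C &
    forall (k : 'rV[R]_d -> 'rV[R]_d -> R) (f g : 'rV[R]_d -> R),
      elliptic_kernel nu Lambda k ->
      inL2 Omega (cst 1) f ->
      inL2 (~` Omega) (fun y => (nu_tilde nu B y)^-1) g ->
      exists u : 'rV[R]_d -> R,
        [/\ robin_weak_solution nu k Omega beta f g u,
            forall u', robin_weak_solution nu k Omega beta f g u' ->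
              ae_eq_on setT u' u &
            Vnorm nu Omega u <=
              C * (L2norm Omega (cst 1) f +
                   L2norm (~` Omega) (fun y => (nu_tilde nu B y)^-1) g)].
Proof.
exact: robin_wellposed.
Qed.
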